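(* Suppose that there does not exist a primal-dual triple $(x,y,z)$ satisfying the KKT conditions of the pair (P)-(D), namely $c+Qx-A^Ty-z=0$, $Ax-b=0$, $XZe_n=0$, $(x,z)\ge(0,0)$. Then it is not the case that, during the iterations of Algorithm IP-PMM, the sequences $\{\|y_k-\lambda_k\|_2\}$ and $\{\|x_k-\zeta_k\|_2\}$ both remain bounded.
   Context: Problem. $A\in\mathbb{R}^{m\times n}$ with $m\le n$, $Q\in\mathbb{R}^{n\times n}$ is symmetric positive semi-definite, $b\in\mathbb{R}^m$, $c\in\mathbb{R}^n$. The primal-dual pair is (P) $\min_x\ c^Tx+\frac12x^TQx$ s.t. $Ax=b$, $x\ge0$; (D) $\max_{x,y,z}\ b^Ty-\frac12x^TQx$ s.t. $-Qx+A^Ty+z=c$, $z\ge0$. No further assumption (such as full row rank of $A$ or existence of a solution) is made. Notation. Superscripts denote components; $e_n$ is the all-ones vector; $X,Z$ (resp. $X_k,Z_k$) are the diagonal matrices with diagonals $x,z$ (resp. $x_k,z_k$). $O(1)$ denotes a quantity bounded by a constant independent of $n$ and $m$. Semi-norm. For $b'\in\mathbb{R}^m,\ c'\in\mathbb{R}^n$: $\|(b',c')\|_{\mathcal A}:=\min_{x,y,z}\{\|(x,z)\|_2: Ax=b',\ -Qx+A^Ty+z=c'\}$ (with value $+\infty$ if the constraint set is empty). Starting point. $(x_0,z_0)=\rho(e_n,e_n)$ for some constant $\rho>0$; $y_0$ is any vector with $\|y_0\|_\infty=O(1)$; $\mu_0=x_0^Tz_0/n$; $\bar b:=Ax_0-b$,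 $\bar c:=-Qx_0+A^Ty_0+z_0-c$; $\zeta_0=x_0$, $\lambda_0=y_0$. Neighbourhood. Fix constants $C_N>0$, $\gamma_{\mathcal A},\gamma_\mu\in(0,1)$. For $\mu>0$, $\zeta\in\mathbb{R}^n$, $\lambda\in\mathbb{R}^m$, $\mathcal N_\mu(\zeta,\lambda)$ is the set of $(x,y,z)$ with $(x,z)>(0,0)$, $x^iz^i\ge\gamma_\mu\mu$ for all $i\in\{1,\dots,n\}$, and such that for some $\tilde b\in\mathbb{R}^m,\tilde c\in\mathbb{R}^n$ with $\|(\tilde b,\tilde c)\|_2\le C_N$, $\|(\tilde b,\tilde c)\|_{\mathcal A}\le\gamma_{\mathcal A}\rho$: $Ax+\mu(y-\lambda)=b+\frac{\mu}{\mu_0}(\bar b+\tilde b)$, $\ -Qx+A^Ty+z-\mu(x-\zeta)=c+\frac{\mu}{\mu_0}(\bar c+\tilde c)$. Algorithm IP-PMM. Parameters $0<\sigma_{\min}\le\sigma_{\max}\le0.5$, the constants $C_N>0$ and $\gamma_{\mathcal A},\gamma_\mu\in(0,1)$ used to define the neighbourhood $\mathcal N_\mu(\zeta,\lambda)$, and a tolerance $\mathrm{tol}$. For $k=0,1,2,\dots$: if $\|Ax_k-b\|_2<\mathrm{tol}$, $\|c+Qx_k-A^Ty_k-z_k\|_2<\mathrm{tol}$ and $\mu_k<\mathrm{tol}$, return $(x_k,y_k,z_k)$. (Statements about infinite sequences of iterates refer to the iteration continued without this stopping test.) Otherwise: (a) choose $\sigma_k\in[\sigma_{\min},\sigma_{\max}]$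 and compute the Newton direction $(\Delta x_k,\Delta y_k,\Delta z_k)$ from $-(Q+\mu_kI_n)\Delta x_k+A^T\Delta y_k+\Delta z_k=(c+\frac{\sigma_k\mu_k}{\mu_0}\bar c)+Qx_k-A^Ty_k-z_k+\sigma_k\mu_k(x_k-\zeta_k)$, $A\Delta x_k+\mu_k\Delta y_k=(b+\frac{\sigma_k\mu_k}{\mu_0}\bar b)-Ax_k-\sigma_k\mu_k(y_k-\lambda_k)$, $Z_k\Delta x_k+X_k\Delta z_k=-X_kZ_ke_n+\sigma_k\mu_ke_n$; (b) let $\alpha_k$ be the largest $\alpha\in(0,1]$ such that $\mu_k(\alpha)\le(1-0.01\alpha)\mu_k$ and $(x_k+\alpha\Delta x_k,y_k+\alpha\Delta y_k,z_k+\alpha\Delta z_k)\in\mathcal N_{\mu_k(\alpha)}(\zeta_k,\lambda_k)$, where $\mu_k(\alpha)=\frac{(x_k+\alpha\Delta x_k)^T(z_k+\alpha\Delta z_k)}{n}$; (c) set $(x_{k+1},y_{k+1},z_{k+1})=(x_k,y_k,z_k)+\alpha_k(\Delta x_k,\Delta y_k,\Delta z_k)$, $\mu_{k+1}=x_{k+1}^Tz_{k+1}/n$; (d) let $r_p=Ax_{k+1}-(b+\frac{\mu_{k+1}}{\mu_0}\bar b)$, $r_d=-Qx_{k+1}+A^Ty_{k+1}+z_{k+1}-(c+\frac{\mu_{k+1}}{\mu_0}\bar c)$. If $\|(r_p,r_d)\|_2\le C_N\frac{\mu_{k+1}}{\mu_0}$ and $\|(r_p,r_d)\|_{\mathcal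 A}\le\gamma_{\mathcal A}\rho\frac{\mu_{k+1}}{\mu_0}$, set $(\zeta_{k+1},\lambda_{k+1})=(x_{k+1},y_{k+1})$; otherwise $(\zeta_{k+1},\lambda_{k+1})=(\zeta_k,\lambda_k)$. *)

(* Defs.v *)
From mathcomp Require Import all_boot all_order all_algebra.
From mathcomp Require Import all_classical all_reals all_analysis.

Set Implicit Arguments.
Unset Strict Implicit.
Unset Printing Implicit Defensive.

Import Order.TTheory GRing.Theory Num.Theory.
Import numFieldNormedType.Exports.

Local Open Scope classical_set_scope.
Local Open Scope ring_scope.

(* Euclidean norm; the library's norm on matrices is the max-norm. *)
Definition norm2 (R : realType) (p : nat) (v : 'cV[R]_p) : R :=
  Num.sqrt (\sum_i v i 0 ^+ 2).

Definition psd (R : realType) (n : nat) (Q : 'M[R]_n) : Prop :=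
  Q^T = Q /\ forall x : 'cV[R]_n, 0 <= (x^T *m Q *m x) 0 0.

Definition dg (R : realType) (n : nat) (x : 'cV[R]_n) : 'M[R]_n :=
  diag_mx x^T.

Definition ones (R : realType) (n : nat) : 'cV[R]_n := const_mx 1.
Arguments ones {R n}.

Definition compl_mu (R : realType) (n : nat) (x z : 'cV[R]_n) : R :=
  (x^T *m z) 0 0 / n%:R.

Definition KKT (R : realType) (m n : nat) (A : 'M[R]_(m, n)) (Q : 'M[R]_n)
    (b : 'cV[R]_m) (c : 'cV[R]_n) (x : 'cV[R]_n) (y : 'cV[R]_m)
    (z : 'cV[R]_n) : Prop :=
  [/\ c + Q *m x - A^T *m y - z = 0,
      A *m x - b = 0,
      dg x *m dg z *m ones = 0 &
      forall i, 0 <= x i 0 /\ 0 <= z i 0].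

(* The minimum over a nonempty constraint set is attained (least-norm point
   of an affine set), so the infimum below is that minimum; the infimum of the
   empty set is +oo. *)
Definition normA (R : realType) (m n : nat) (A : 'M[R]_(m, n)) (Q : 'M[R]_n)
    (b' : 'cV[R]_m) (c' : 'cV[R]_n) : \bar R :=
  ereal_inf [set r : \bar R | exists x : 'cV[R]_n, exists y : 'cV[R]_m,
    exists z : 'cV[R]_n,
    [/\ A *m x = b', - (Q *m x) + A^T *m y + z = c' &
        r = (norm2 (col_mx x z))%:E]].

(* One state of the algorithm: the iterate (x_k, y_k, z_k) and the proximal
   estimates (zeta_k, lambda_k). *)
Record state (R : realType) (m n : nat) := State {
  st_x : 'cV[R]_n;
  st_y : 'cV[R]_m;
  st_z : 'cV[R]_n;
  st_zeta : 'cV[R]_n;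
  st_lam : 'cV[R]_m }.

Section IPPMM.
Variables (R : realType) (m n : nat).
Variables (A : 'M[R]_(m, n)) (Q : 'M[R]_n) (b : 'cV[R]_m) (c : 'cV[R]_n).
Variables (rho : R) (y0 : 'cV[R]_m).
Variables (CN gA gmu smin smax : R).

Definition x0 : 'cV[R]_n := rho *: ones.
Definition z0 : 'cV[R]_n := rho *: ones.
Definition mu0 : R := compl_mu x0 z0.
Definition bbar : 'cV[R]_m := A *m x0 - b.
Definition cbar : 'cV[R]_n := - (Q *m x0) + A^T *m y0 + z0 - c.

Definition init_state : state R m n := State x0 y0 z0 x0 y0.

Definition nbhd (mu : R) (zeta : 'cV[R]_n) (lam : 'cV[R]_m)
    (x : 'cV[R]_n) (y : 'cV[R]_m) (z : 'cV[R]_n) : Prop :=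
  [/\ forall i, 0 < x i 0 /\ 0 < z i 0,
      forall i, gmu * mu <= x i 0 * z i 0 &
      exists bt : 'cV[R]_m, exists ct : 'cV[R]_n,
        [/\ norm2 (col_mx bt ct) <= CN,
            (normA A Q bt ct <= (gA * rho)%:E)%E,
            A *m x + mu *: (y - lam) = b + (mu / mu0) *: (bbar + bt) &
            - (Q *m x) + A^T *m y + z - mu *: (x - zeta)
              = c + (mu / mu0) *: (cbar + ct)]].

Definition newton (s : state R m n) (sigma : R)
    (dx : 'cV[R]_n) (dy : 'cV[R]_m) (dz : 'cV[R]_n) : Prop :=
  let: State x y z zeta lam := s in
  let mu := compl_mu x z in
  [/\ - ((Q + mu%:M) *m dx) + A^T *m dy + dz
        = (c + (sigma * mu / mu0) *: cbar) + Q *m x - A^T *m y - z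
          + (sigma * mu) *: (x - zeta),
      A *m dx + mu *: dy
        = (b + (sigma * mu / mu0) *: bbar) - A *m x
          - (sigma * mu) *: (y - lam) &
      dg z *m dx + dg x *m dz
        = - (dg x *m dg z *m ones) + (sigma * mu) *: ones].

Definition admissible_step (s : state R m n)
    (dx : 'cV[R]_n) (dy : 'cV[R]_m) (dz : 'cV[R]_n) (alpha : R) : Prop :=
  let: State x y z zeta lam := s in
  let mu_alpha := compl_mu (x + alpha *: dx) (z + alpha *: dz) in
  [/\ 0 < alpha <= 1,
      mu_alpha <= (1 - alpha / 100%:R) * compl_mu x z &
      nbhd mu_alpha zeta lam
        (x + alpha *: dx) (y + alpha *: dy) (z + alpha *: dz)].

Definition step_length (s : state R m n)
    (dx : 'cV[R]_n) (dy : 'cV[R]_m) (dz : 'cV[R]_n) (alpha : R) : Prop :=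
  admissible_step s dx dy dz alpha /\
  forall beta, admissible_step s dx dy dz beta -> beta <= alpha.

Definition estimate_update_test
    (x : 'cV[R]_n) (y : 'cV[R]_m) (z : 'cV[R]_n) : Prop :=
  let mu := compl_mu x z in
  let rp := A *m x - (b + (mu / mu0) *: bbar) in
  let rd := - (Q *m x) + A^T *m y + z - (c + (mu / mu0) *: cbar) in
  norm2 (col_mx rp rd) <= CN * (mu / mu0) /\
  (normA A Q rp rd <= (gA * rho * (mu / mu0))%:E)%E.

Definition ippmm_step (s s' : state R m n) : Prop :=
  exists sigma : R, exists dx : 'cV[R]_n, exists dy : 'cV[R]_m,
  exists dz : 'cV[R]_n, exists alpha : R,
  [/\ smin <= sigma <= smax,
      newton s sigma dx dy dz,
      step_length s dx dy dz alpha,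
      [/\ st_x s' = st_x s + alpha *: dx,
          st_y s' = st_y s + alpha *: dy &
          st_z s' = st_z s + alpha *: dz] &
      let accept := estimate_update_test (st_x s') (st_y s') (st_z s') in
      (accept -> st_zeta s' = st_x s' /\ st_lam s' = st_y s') /\
      (~ accept -> st_zeta s' = st_zeta s /\ st_lam s' = st_lam s)].

(* Infinite runs: the iteration without its tolerance-based stopping test. *)
Definition ippmm_run (s : nat -> state R m n) : Prop :=
  s 0%N = init_state /\ forall k, ippmm_step (s k) (s k.+1).

End IPPMM.

(* Main.v *)
Require Import Defs.
From mathcomp Require Import all_boot all_order all_algebra.
From mathcomp Require Import all_classical all_reals all_analysis.
From mathcomp Require Import ring lra.

Import Order.TTheory GRing.Theory Num.Theory.
Import numFieldNormedType.Exports.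
Local Open Scope ring_scope.

(* Suppose both proximal sequences stay bounded. If the complementarity measure
   mu_k stayed above some mulo > 0, the proximal terms mu_k I would make the
   Newton directions bounded independently of the size of the iterates, since
   the right-hand sides of the Newton system only involve the residuals, x - zeta
   and y - lambda; a fixed step length would then always be admissible and
   mu_k would decrease by a fixed amount at each iteration. This needs b in the
   range of A, as otherwise the semi-norm of the new residual is infinite; but
   in that case no step is admissible at the starting point. So mu_k gets
   arbitrarily small, and the neighbourhood equations make the iterates
   approximate KKT points with x_i z_i -> 0. For each i the smaller of x_i and
   z_i can be rounded to 0, which leaves finitely many complementarity patterns;
   for each of them the KKT system asks for membership in a finitely generated
   cone, and such cones are closed. *)

(** * Euclidean norm *)

Section Norm2.
Variable R : realType.
Implicit Types p q : nat.

Lemma norm2_ge0 p (v : 'cV[R]_p) : 0 <= norm2 v.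
Proof. exact: sqrtr_ge0. Qed.

Lemma norm2_sqr p (v : 'cV[R]_p) : norm2 v ^+ 2 = \sum_i v i 0 ^+ 2.
Proof. by rewrite sqr_sqrtr // sumr_ge0 // => i _; exact: sqr_ge0. Qed.

Lemma norm2_le p (v : 'cV[R]_p) (r : R) :
  0 <= r -> \sum_i v i 0 ^+ 2 <= r ^+ 2 -> norm2 v <= r.
Proof. by move=> r0; rewrite -norm2_sqr ler_sqr ?nnegrE ?norm2_ge0. Qed.

Lemma norm2Z p (a : R) (v : 'cV[R]_p) : norm2 (a *: v) = `|a| * norm2 v.
Proof.
rewrite /norm2; under eq_bigr do rewrite mxE exprMn.
by rewrite -mulr_sumr sqrtrM ?sqr_ge0// sqrtr_sqr.
Qed.

Lemma ler_norm_norm2 p (v : 'cV[R]_p) i : `|v i 0| <= norm2 v.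
Proof.
rewrite -ler_sqr ?nnegrE ?norm2_ge0// norm2_sqr real_normK ?num_real//.
by rewrite (bigD1 i)//= lerDl sumr_ge0 // => j _; exact: sqr_ge0.
Qed.

(** Cauchy-Schwarz. Vectors of norm 0 are treated first, since the argument divides by the product
    of the norms. *)
Lemma dot_le_norm2 p (u v : 'cV[R]_p) :
  \sum_i u i 0 * v i 0 <= norm2 u * norm2 v.
Proof.
have dot0 (w w' : 'cV[R]_p) : norm2 w = 0 -> \sum_i w i 0 * w' i 0 = 0.
  move=> w0; apply: big1 => i _; have := ler_norm_norm2 _ w i.
  by rewrite w0 normr_le0 => /eqP ->; rewrite mul0r.
have := norm2_ge0 _ u; rewrite le_eqVlt => /predU1P[/esym u0|u_gt0].
  by rewrite dot0// u0 mul0r.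
have := norm2_ge0 _ v; rewrite le_eqVlt => /predU1P[/esym v0|v_gt0].
  by under eq_bigr do rewrite mulrC; rewrite dot0// v0 mulr0.
set a := norm2 u; set b := norm2 v.
(* Scaling each vector by the norm of the other makes the two square terms equal, and the cross term
   gives the claim. *)
have : 0 <= \sum_i (u i 0 * b - v i 0 * a) ^+ 2.
  by apply: sumr_ge0 => i _; exact: sqr_ge0.
have -> : \sum_i (u i 0 * b - v i 0 * a) ^+ 2 =
    b ^+ 2 * (\sum_i u i 0 ^+ 2) + a ^+ 2 * (\sum_i v i 0 ^+ 2)
    - (2 * a * b) * (\sum_i u i 0 * v i 0).
  by rewrite !mulr_sumr -big_split/= -sumrB; apply: eq_bigr => i _; ring.
rewrite -!norm2_sqr -/a -/b subr_ge0.
have -> : b ^+ 2 * a ^+ 2 + a ^+ 2 * b ^+ 2 = (2 * a * b) * (a * b) by ring.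
by rewrite ler_pM2l// !mulr_gt0.
Qed.

Lemma norm2D p (u v : 'cV[R]_p) : norm2 (u + v) <= norm2 u + norm2 v.
Proof.
apply: norm2_le; first by rewrite addr_ge0 ?norm2_ge0.
have -> : \sum_i (u + v) i 0 ^+ 2 = \sum_i u i 0 ^+ 2 + \sum_i v i 0 ^+ 2 +
    2 * \sum_i u i 0 * v i 0.
  by rewrite mulr_sumr -!big_split; apply: eq_bigr => i _ /=; rewrite !mxE; ring.
have := dot_le_norm2 _ u v; rewrite -!norm2_sqr; lra.
Qed.

Lemma norm2_col_mx_sqr p q (u : 'cV[R]_p) (v : 'cV[R]_q) :
  norm2 (col_mx u v) ^+ 2 = norm2 u ^+ 2 + norm2 v ^+ 2.
Proof.
rewrite !norm2_sqr big_split_ord/=; congr (_ + _).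
  by apply: eq_bigr => i _; rewrite col_mxEu.
by apply: eq_bigr => i _; rewrite col_mxEd.
Qed.

Lemma norm2_le_col_mxl p q (u : 'cV[R]_p) (v : 'cV[R]_q) :
  norm2 u <= norm2 (col_mx u v).
Proof.
by rewrite -ler_sqr ?nnegrE ?norm2_ge0// norm2_col_mx_sqr lerDl sqr_ge0.
Qed.

Lemma norm2_le_col_mxr p q (u : 'cV[R]_p) (v : 'cV[R]_q) :
  norm2 v <= norm2 (col_mx u v).
Proof.
by rewrite -ler_sqr ?nnegrE ?norm2_ge0// norm2_col_mx_sqr lerDr sqr_ge0.
Qed.

Lemma norm2_col_mx_le p q (u : 'cV[R]_p) (v : 'cV[R]_q) :
  norm2 (col_mx u v) <= norm2 u + norm2 v.
Proof.
have u0 := norm2_ge0 _ u; have v0 := norm2_ge0 _ v.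
rewrite -ler_sqr ?nnegrE ?norm2_ge0 ?addr_ge0//.
rewrite norm2_col_mx_sqr sqrrD addrAC lerDl mulrn_wge0// mulr_ge0//.
Qed.

Lemma norm2_le_sum p (v : 'cV[R]_p) : norm2 v <= \sum_i `|v i 0|.
Proof.
elim: p v => [|p IHp] v.
  by rewrite /norm2 !big_ord0 sqrtr0.
rewrite -[p.+1]/(1 + p)%N in v *; rewrite -(vsubmxK v).
apply: (le_trans (norm2_col_mx_le _ _ _ _)).
rewrite big_split_ord/= lerD//.
  by rewrite /norm2 !big_ord1 sqrtr_sqr col_mxEu.
by under eq_bigr do rewrite col_mxEd; exact: IHp.
Qed.

Lemma mulmx_bounded p q (M : 'M[R]_(p, q)) :
  exists2 K : R, 0 <= K & forall v, norm2 (M *m v) <= K * norm2 v.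
Proof.
exists (\sum_i \sum_j `|M i j|); first by rewrite !sumr_ge0// => *; rewrite sumr_ge0.
move=> v; apply: (le_trans (norm2_le_sum _ _)); rewrite mulr_suml ler_sum// => i _.
rewrite mxE mulr_suml; apply: (le_trans (ler_norm_sum _ _ _)).
by rewrite ler_sum// => j _; rewrite normrM ler_wpM2l// ler_norm_norm2.
Qed.

Lemma dgE p (x w : 'cV[R]_p) i : (dg x *m w) i 0 = x i 0 * w i 0.
Proof. by rewrite /dg mul_diag_mx !mxE. Qed.

End Norm2.

(** Exchanges quantifiers: a choice from a finite type that may depend on [e] can be made once for
    all [e]. It stands in for the extraction of subsequences. *)
Lemma pigeonhole_eps (R : realType) (T : finType) (P : T -> R -> Prop) :
  (forall t e e', e <= e' -> P t e -> P t e') ->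
  (forall e, 0 < e -> exists t, P t e) ->
  exists t, forall e, 0 < e -> P t e.
Proof.
move=> Pmono Pex; apply: contrapT => /forallNP noP.
have /choice[f fP] : forall t, exists e : R, 0 < e /\ ~ P t e.
  by move=> t; have /existsNP[e /not_implyP[e0 nP]] := noP t; exists e.
(* If each [t] failed at some [f t], the smallest of these values would, by monotonicity, be one at
   which every [t] fails. *)
have e0 : 0 < \big[Num.min/1]_t f t by apply: lt_bigmin => // t _; have [] := fP t.
have [t Pt] := Pex _ e0; have [_] := fP t; apply.
by apply: Pmono Pt; exact: bigmin_le.
Qed.

(** * Finitely generated cones and approximate KKT points *)

Section Cone.
Variable R : realType.

Lemma le0_eps (a K : R) : 0 <= K -> (forall e, 0 < e -> a <= K * e) -> a <= 0.
Proof.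
move=> K0 aK; rewrite leNgt; apply/negP => a0.
have K1 : 0 < K + 1 by rewrite ltr_wpDl.
have := aK (a / (2 * (K + 1))) ltac:(by rewrite divr_gt0// mulr_gt0).
apply/negP; rewrite -ltNge mulrA ltr_pdivrMr ?mulr_gt0// mulrC.
by rewrite ltr_pM2l//; lra.
Qed.

Lemma eq0_eps p (v : 'cV[R]_p) (K : R) :
  0 <= K -> (forall e, 0 < e -> norm2 v <= K * e) -> v = 0.
Proof.
move=> K0 /(le0_eps _ _ K0) v0; apply/matrixP => i j; rewrite ord1 mxE.
by apply/eqP; rewrite -normr_le0 (le_trans (ler_norm_norm2 _ _ _ _)).
Qed.

Lemma left_inverse p q (M : 'M[R]_(p, q)) :
  (forall w : 'cV[R]_q, M *m w = 0 -> w = 0) -> exists L, L *m M = 1%:M.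
Proof.
move=> Minj; have Mfree : row_free M^T.
  rewrite -kermx_eq0; apply/eqP/row_matrixP => i.
  rewrite row0; apply: trmx_inj; rewrite trmx0; apply: Minj.
  apply: trmx_inj; rewrite trmx_mul trmxK trmx0.
  by apply/sub_kermxP; exact: row_sub.
exists (pinvmx M^T)^T; apply: trmx_inj.
by rewrite trmx_mul trmxK mulmxVp// trmx1.
Qed.

(** The only candidate solution is known in advance from a left inverse, and every approximant lies
    within a multiple of [e] of it; the sign, support and equality conditions then pass to the
    limit. *)
Lemma cone_closed_inj p q (M : 'M[R]_(p, q)) (v : 'cV[R]_p) (I : {set 'I_q}) :
  (forall w : 'cV[R]_q, (forall i, i \notin I -> w i 0 = 0) ->
     M *m w = 0 -> w = 0) ->
  (forall e, 0 < e -> exists u : 'cV[R]_q, [/\ forall i, 0 <= u i 0,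
     forall i, i \notin I -> u i 0 = 0 & norm2 (M *m u - v) <= e]) ->
  exists u : 'cV[R]_q, [/\ forall i, 0 <= u i 0,
     forall i, i \notin I -> u i 0 = 0 & M *m u = v].
Proof.
move=> Minj app.
(* [D] reads off the coordinates outside [I], so that stacking it under [M] gives a matrix with
   trivial kernel. *)
pose D : 'M[R]_q := diag_mx (\row_i (i \notin I)%:R).
have DE (w : 'cV[R]_q) i : (D *m w) i 0 = (i \notin I)%:R * w i 0.
  by rewrite mul_diag_mx !mxE.
have [|L LM] := left_inverse _ _ (col_mx M D).
  move=> w; rewrite mul_col_mx => /eqP; rewrite col_mx_eq0 => /andP[/eqP Mw /eqP Dw].
  apply: Minj => // i iI; have := DE w i.
  by rewrite Dw mxE iI mul1r.
have [K K0 LK] := mulmx_bounded _ _ _ L.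
have [K' K'0 MK] := mulmx_bounded _ _ _ M.
pose u0 := L *m col_mx v 0.
have close e : 0 < e -> exists u : 'cV[R]_q, [/\ forall i, 0 <= u i 0,
    forall i, i \notin I -> u i 0 = 0, norm2 (M *m u - v) <= e &
    norm2 (u - u0) <= K * e].
  move=> e0; have [u [u_ge0 uI Mu]] := app _ e0; exists u; split=> //.
  have Du : D *m u = 0.
    apply/matrixP => i j; rewrite ord1 DE mxE.
    by case: (boolP (i \in I)) => [_|/uI ->]; rewrite ?mul0r ?mulr0.
  have -> : u - u0 = L *m col_mx (M *m u - v) 0.
    rewrite -[u in LHS]mul1mx -LM -mulmxA /u0 -mulmxBr mul_col_mx Du.
    by rewrite opp_col_mx add_col_mx subr0.
  apply: (le_trans (LK _)); rewrite ler_wpM2l//.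
  apply: (le_trans (norm2_col_mx_le _ _ _ _ _)); rewrite {2}/norm2.
  by rewrite big1 ?sqrtr0 ?addr0// => i _; rewrite mxE expr0n.
exists u0; split.
- move=> i; rewrite -oppr_le0; apply: (le0_eps _ _ K0) => e /close[u [u_ge0 _ _ uu0]].
  have := ler_norm_norm2 _ _ (u - u0) i; rewrite !mxE => /le_trans/(_ uu0).
  by rewrite ler_norml => /andP[_]; have := u_ge0 i; lra.
- move=> i iI; apply/eqP; rewrite -normr_le0.
  apply: (le0_eps _ _ K0) => e /close[u [_ uI _ uu0]].
  have := ler_norm_norm2 _ _ (u - u0) i; rewrite !mxE uI// sub0r normrN.
  by move=> /le_trans/(_ uu0).
- apply/eqP; rewrite -subr_eq0; apply/eqP.
  apply: (eq0_eps _ _ (1 + K' * K)); first by rewrite addr_ge0 ?mulr_ge0.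
  move=> e /close[u [_ _ Mu uu0]].
  have -> : M *m u0 - v = (M *m u - v) + (-1) *: (M *m (u - u0)).
    by rewrite mulmxBr scaleN1r opprB [RHS]addrC addrA subrK.
  apply: (le_trans (norm2D _ _ _ _)); rewrite mulrDl mul1r lerD//.
  rewrite norm2Z normrN1 mul1r (le_trans (MK _))// -mulrA ler_wpM2l//.
Qed.

(* Induction on the support [I]: a kernel vector supported in [I] lets every
   approximant be moved to the boundary of the orthant, which shrinks [I]; if
   there is none, [M] has a bounded left inverse on the vectors supported in
   [I], so that the approximants converge. *)
Lemma cone_closed_supp p q (M : 'M[R]_(p, q)) (v : 'cV[R]_p) (I : {set 'I_q}) :
  (forall e, 0 < e -> exists u : 'cV[R]_q, [/\ forall i, 0 <= u i 0,
     forall i, i \notin I -> u i 0 = 0 & norm2 (M *m u - v) <= e]) ->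
  exists u : 'cV[R]_q, [/\ forall i, 0 <= u i 0,
     forall i, i \notin I -> u i 0 = 0 & M *m u = v].
Proof.
elim: {I}#|I| {-2}I (erefl #|I|) => [|N IHN] I cardI app.
  apply: cone_closed_inj app => w wI _; apply/matrixP => i j; rewrite ord1 mxE wI//.
  by rewrite (cards0_eq cardI) inE.
have [[w [w_neq0 wI Mw]]|nker] := pselect (exists w : 'cV[R]_q,
  [/\ w != 0, forall i, i \notin I -> w i 0 = 0 & M *m w = 0]).
  (* The ratio test below needs a positive entry; [- w] is a kernel vector as well. *)
  wlog [i0 wi0] : w w_neq0 wI Mw / exists i, 0 < w i 0.
    move=> wlogw; have [//|nw] := pselect (exists i, 0 < w i 0).
      exact: wlogw w_neq0 wI Mw.
    apply: (wlogw (- w)); rewrite ?oppr_eq0// ?mulmxN ?Mw ?oppr0//.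
      by move=> i iI; rewrite mxE wI// oppr0.
    apply: contrapT => /forallNP nNw; case/eqP: w_neq0.
    apply/matrixP => i j; rewrite ord1 mxE; apply/eqP.
    have /negP := nNw i; rewrite mxE oppr_gt0 => wi.
    move/forallNP: nw => /(_ i)/negP; lra.
  suff [i [iI iapp]] : exists i, i \in I /\ forall e, 0 < e ->
      exists u : 'cV[R]_q, [/\ forall j, 0 <= u j 0,
        forall j, j \notin I :\ i -> u j 0 = 0 & norm2 (M *m u - v) <= e].
    have [|u [u0 uI Mu]] := IHN (I :\ i) _ iapp.
      by move: cardI; rewrite (cardsD1 i) iI add1n => -[].
    exists u; split=> // j jI; apply: uI; apply: contra jI.
    by rewrite in_setD1 => /andP[].
  (* The index that leaves the support depends on the approximant, hence on [e], but ranges over a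
     finite type. *)
  have := @pigeonhole_eps R 'I_q (fun i e => i \in I /\
      exists u : 'cV[R]_q, [/\ forall j, 0 <= u j 0,
        forall j, j \notin I :\ i -> u j 0 = 0 & norm2 (M *m u - v) <= e]).
  case.
  - move=> t e e' ee' [tI [u [u1 u2 u3]]]; split => //.
    by exists u; split => //; exact: le_trans ee'.
  - move=> e /app[u [u_ge0 uI Mu]].
    (* Ratio test of the simplex method: moving along [- w] until the first coordinate vanishes
       keeps [u] nonnegative and leaves [M *m u] unchanged. *)
    pose i := [arg min_(i < i0 | 0 < w i 0) (u i 0 / w i 0)]%O.
    have [wi imin] : 0 < w i 0 /\ forall j, 0 < w j 0 ->
        u i 0 / w i 0 <= u j 0 / w j 0.
      by rewrite /i; case: arg_minP.
    have iI : i \in I by apply: contraT => /wI wi0'; move: wi; rewrite wi0' ltxx.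
    exists i; split=> //; exists (u - (u i 0 / w i 0) *: w); split.
    + move=> j; rewrite !mxE subr_ge0; have [wj|wj] := ltP 0 (w j 0).
        by rewrite -ler_pdivlMr// imin.
      by rewrite (le_trans _ (u_ge0 j))// mulr_ge0_le0// divr_ge0// ltW.
    + move=> j; rewrite in_setD1 negb_and negbK !mxE => /orP[/eqP ->|jI].
        by rewrite divfK ?subrr// gt_eqF.
      by rewrite (uI j)// (wI j)// mulr0 subr0.
    + by rewrite mulmxBr -scalemxAr Mw scaler0 subr0.
  move=> i iP; exists i; split; first by have [] := iP _ ltr01.
  by move=> e /iP[].
apply: cone_closed_inj app => w wI Mw; apply: contrapT => /eqP w0.
by apply: nker; exists w.
Qed.

Lemma cone_closed p q (M : 'M[R]_(p, q)) (v : 'cV[R]_p) :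
  (forall e, 0 < e -> exists u : 'cV[R]_q,
     (forall i, 0 <= u i 0) /\ norm2 (M *m u - v) <= e) ->
  exists u : 'cV[R]_q, (forall i, 0 <= u i 0) /\ M *m u = v.
Proof.
move=> app; have [|u [u0 _ Mu]] := @cone_closed_supp _ _ M v [set: 'I_q].
  move=> e /app[u [u0 Mu]]; exists u; split=> // i.
  by rewrite inE.
by exists u.
Qed.

(* Since [x i 0 * z i 0] is small, one of the two factors is; the smaller one
   is rounded to 0, which fixes the complementarity pattern. *)
Lemma approx_KKT m n (A : 'M[R]_(m, n)) (Q : 'M[R]_n) (b : 'cV[R]_m)
    (c : 'cV[R]_n) :
  (forall e, 0 < e -> exists (x : 'cV[R]_n) (y : 'cV[R]_m) (z : 'cV[R]_n),
    [/\ forall i, 0 <= x i 0 /\ 0 <= z i 0,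
        forall i, x i 0 * z i 0 <= e,
        norm2 (A *m x - b) <= e &
        norm2 (- (Q *m x) + A^T *m y + z - c) <= e]) ->
  exists x y z, KKT A Q b c x y z.
Proof.
move=> app.
pose D (f : 'I_n -> bool) : 'M[R]_n := diag_mx (\row_i (f i)%:R).
have DE f (w : 'cV[R]_n) i : (D f *m w) i 0 = (f i)%:R * w i 0.
  by rewrite mul_diag_mx !mxE.
have [KA KA0 HA] := mulmx_bounded _ _ _ A.
have [KQ KQ0 HQ] := mulmx_bounded _ _ _ Q.
(* The 2 accounts for the two given residuals; the rest bounds the images under [A] and [Q] of the
   rounding error in [x], and the rounding error in [z]. *)
pose K : R := 2 + n%:R * (KA + KQ + 1).
(* KKT system for the pattern [f]: the masks make [x] and [z] complementary, and the free variable
   [y] is written as a difference of nonnegative vectors, so that all unknowns range over the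
   orthant. *)
pose N f : 'M[R]_(m + n, n + (n + (m + m))) :=
  col_mx (row_mx (A *m D f) 0)
    (row_mx (- (Q *m D f)) (row_mx (D (predC f)) (row_mx A^T (- A^T)))).
have NE f (x z : 'cV[R]_n) (y y' : 'cV[R]_m) :
    N f *m col_mx x (col_mx z (col_mx y y')) =
    col_mx (A *m (D f *m x))
      (- (Q *m (D f *m x)) + A^T *m (y - y') + D (predC f) *m z).
  rewrite mul_col_mx !mul_row_col mul0mx addr0 !mulNmx !mulmxA mulmxBr.
  by congr col_mx; rewrite -[RHS]addrA [in RHS](addrC (_ - _)).
have [f fP] : exists f : {ffun 'I_n -> bool}, forall e, 0 < e ->
    exists u : 'cV[R]_(n + (n + (m + m))),
      (forall i, 0 <= u i 0) /\ norm2 (N f *m u - col_mx b c) <= e.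
  apply: pigeonhole_eps => [f e e' ee' [u [u0 Nu]]|e e0].
    by exists u; split=> //; exact: le_trans ee'.
  have K0 : 0 < K by rewrite ltr_wpDr// mulr_ge0// !addr_ge0.
  (* The bound by 1 ensures [d ^+ 2 <= d]; products at most [d ^+ 2] make the smaller factor at most
     [d]. *)
  pose d := Num.min 1 (e / K).
  have d0 : 0 < d by rewrite lt_min ltr01 divr_gt0.
  have [x [y [z [xz0 xzd Ax Qx]]]] := app (d ^+ 2) (exprn_gt0 _ d0).
  (* The larger of the two entries is kept, so the square of the dropped one is at most the
     product. *)
  pose f := [ffun i => z i 0 <= x i 0].
  exists f.
  pose yp := \col_i Num.max (y i 0) 0; pose yn := \col_i Num.max (- y i 0) 0.
  exists (col_mx x (col_mx z (col_mx yp yn))); split.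
    move=> i; rewrite !mxE; case: splitP => j _; first by have [] := xz0 j.
    rewrite !mxE; case: splitP => k _; first by have [] := xz0 k.
    by rewrite !mxE; case: splitP => l _; rewrite mxE le_max lexx orbT.
  have ypn : yp - yn = y.
    apply/matrixP => i j; rewrite ord1 !mxE.
    by case: (ltP (y i 0) 0); case: (ltP (- y i 0) 0); lra.
  rewrite NE ypn.
  have small i : `|(x - D f *m x) i 0| <= d /\ `|(z - D (predC f) *m z) i 0| <= d.
    have [x_ge0 z_ge0] := xz0 i; have xzi := xzd i.
    rewrite mxE [X in _ + X]mxE DE mxE [X in _ /\ `|_ + X| <= _]mxE DE /= ffunE.
    have [zx|xz] := leP (z i 0) (x i 0).
      rewrite mul1r mul0r subrr subr0 normr0 ger0_norm// (ltW d0); split=> //.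
      by rewrite -ler_sqr ?nnegrE ?(ltW d0)// (le_trans _ xzi)// expr2 ler_wpM2r.
    rewrite mul1r mul0r subrr subr0 normr0 ger0_norm// (ltW d0); split=> //.
    by rewrite -ler_sqr ?nnegrE ?(ltW d0)// (le_trans _ xzi)// expr2 ler_wpM2l// ltW.
  have norm2n (w : 'cV[R]_n) : (forall i, `|w i 0| <= d) -> norm2 w <= n%:R * d.
    move=> wd; apply: (le_trans (norm2_le_sum _ _ _)).
    by rewrite -[n in n%:R]card_ord mulr_natl -sumr_const ler_sum.
  have dd : d ^+ 2 <= d.
    by rewrite expr2 ger_pMl// ge_min lexx.
  have dK : K * d <= e by rewrite mulrC -ler_pdivlMr// ge_min lexx orbT.
  rewrite opp_col_mx add_col_mx.
  apply: (le_trans (norm2_col_mx_le _ _ _ _ _)); apply: le_trans dK.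
  set ex := x - D f *m x; set ez := z - D (predC f) *m z.
  have -> : A *m (D f *m x) - b = (A *m x - b) + (-1) *: (A *m ex).
    by rewrite mulmxBr scaleN1r opprB [RHS]addrC addrA subrK.
  have -> : - (Q *m (D f *m x)) + A^T *m y + D (predC f) *m z - c =
      (- (Q *m x) + A^T *m y + z - c) + (Q *m ex + (-1) *: ez).
    rewrite mulmxBr scaleN1r /ez.
    set v1 := Q *m x; set v2 := Q *m _; set v3 := _ *m y; set v4 := _ *m z.
    by apply/matrixP => i j; rewrite !mxE; ring.
  have HAx : norm2 (A *m ex) <= KA * (n%:R * d).
    apply: (le_trans (HA _)); rewrite ler_wpM2l// norm2n// => i.
    by have [] := small i.
  have HQx : norm2 (Q *m ex) <= KQ * (n%:R * d).
    apply: (le_trans (HQ _)); rewrite ler_wpM2l// norm2n// => i.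
    by have [] := small i.
  have Hz : norm2 ez <= n%:R * d by apply: norm2n => i; have [] := small i.
  have t1 := norm2D _ _ (A *m x - b) ((-1) *: (A *m ex)).
  have t2 := norm2D _ _ (- (Q *m x) + A^T *m y + z - c) (Q *m ex + (-1) *: ez).
  have t3 := norm2D _ _ (Q *m ex) ((-1) *: ez).
  rewrite !norm2Z normrN1 !mul1r in t1 t2 t3.
  by rewrite /K; lra.
have [u [u0]] := cone_closed _ _ _ _ fP.
rewrite -[u]vsubmxK -[dsubmx u]vsubmxK -[dsubmx (dsubmx u)]vsubmxK NE.
set x := usubmx u; set z := usubmx (dsubmx u); set y := usubmx _; set y' := dsubmx _.
move=> /eq_col_mx[Ab Qc].
exists (D f *m x), (y - y'), (D (predC f) *m z); split.
- by rewrite -Qc; set v1 := _ *m _; set v2 := _ *m (y - y'); set v3 := _ *m z;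
    rewrite -!addrA; apply/matrixP => i j; rewrite !mxE; ring.
- by rewrite Ab subrr.
- apply/matrixP => i j; rewrite ord1 -mulmxA !dgE [ones _ _]mxE [RHS]mxE mulr1 !DE /=.
  by case: (f i); rewrite !(mul0r, mulr0, mul1r).
- move=> i; rewrite !DE; split; apply: mulr_ge0; rewrite ?ler0n//; first by rewrite /x mxE.
  by rewrite /z !mxE.
Qed.
End Cone.

(** * The semi-norm *)

Section NormA.
Variables (R : realType) (m n : nat) (A : 'M[R]_(m, n)) (Q : 'M[R]_n).
Implicit Types (b : 'cV[R]_m) (c : 'cV[R]_n).

(** Working with a slack [e] avoids any appeal to attainment of the infimum. *)
Lemma normA_leP b c (r : R) :
  (normA A Q b c <= r%:E)%E <-> forall e : R, 0 < e -> exists x y z,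
    [/\ A *m x = b, - (Q *m x) + A^T *m y + z = c & norm2 (col_mx x z) <= r + e].
Proof.
split=> [bc_r e e0|bc_r].
  have /ereal_inf_lt[_ [x [y [z [Ax Qx ->]]]]] : (normA A Q b c < (r + e)%:E)%E.
    by rewrite (le_lt_trans bc_r)// lte_fin ltrDl.
  by rewrite lte_fin => /ltW; exists x, y, z.
apply/lee_addgt0Pr => e e0; have [x [y [z [Ax Qx xz]]]] := bc_r _ e0.
apply: (@le_trans _ _ (norm2 (col_mx x z))%:E); last by rewrite -EFinD lee_fin.
by apply: ereal_inf_lbound; exists x, y, z.
Qed.

Lemma normA_range b c (r : R) :
  (normA A Q b c <= r%:E)%E -> exists x, A *m x = b.
Proof. by move=> /normA_leP/(_ _ ltr01)[x [y [z [Ax _ _]]]]; exists x. Qed.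

Lemma normAZ_le b c (t r : R) : 0 <= t ->
  (normA A Q b c <= r%:E)%E -> (normA A Q (t *: b) (t *: c) <= (t * r)%:E)%E.
Proof.
move=> t0 /normA_leP bc; apply/normA_leP => e e0.
(* The slack is divided by [t + 1] rather than [t], which may be 0. *)
have t1 : 0 < t + 1 by rewrite ltr_wpDl.
have [x [y [z [Ax Qx xz]]]] := bc _ (divr_gt0 e0 t1).
exists (t *: x), (t *: y), (t *: z); rewrite -!scalemxAr Ax; split=> //.
  by rewrite -Qx !scalerDr scalerN.
rewrite -scale_col_mx norm2Z ger0_norm//; apply: (le_trans (ler_wpM2l t0 xz)).
rewrite mulrDr lerD2l mulrA ler_pdivrMr// mulrC ler_wpM2l ?ltW//; lra.
Qed.

Lemma normAD_le b c b' c' (r r' : R) :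
  (normA A Q b c <= r%:E)%E -> (normA A Q b' c' <= r'%:E)%E ->
  (normA A Q (b + b') (c + c') <= (r + r')%:E)%E.
Proof.
move=> /normA_leP bc /normA_leP bc'; apply/normA_leP => e e0.
have e2 : 0 < e / 2 by rewrite divr_gt0.
have [x [y [z [Ax Qx xz]]]] := bc _ e2.
have [x' [y' [z' [Ax' Qx' xz']]]] := bc' _ e2.
exists (x + x'), (y + y'), (z + z'); split.
- by rewrite mulmxDr Ax Ax'.
- by rewrite -Qx -Qx' !mulmxDr opprD [RHS]addrACA; congr (_ + _); rewrite addrACA.
- by rewrite -add_col_mx (le_trans (norm2D _ _ _ _))//; lra.
Qed.

(** Since [z] is free, the second constraint can always be met with [y = 0]; only the first can
    fail. A preimage of [b] depending linearly on [b] comes from a pseudo-inverse. *)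
Lemma normA_bounded : exists2 K : R, 0 <= K & forall b c,
  (exists x, A *m x = b) ->
  (normA A Q b c <= (K * (norm2 b + norm2 c))%:E)%E.
Proof.
have [KP KP0 HP] := mulmx_bounded _ _ _ (pinvmx A^T)^T.
have [KQ KQ0 HQ] := mulmx_bounded _ _ _ Q.
exists (KP + KQ * KP + 1); first by rewrite !addr_ge0 ?mulr_ge0.
move=> b c [x0 Ax0]; apply/normA_leP => e e0.
pose x := (pinvmx A^T)^T *m b.
have Ax : A *m x = b.
  apply: trmx_inj; rewrite (trmx_mul A) (trmx_mul _ b) trmxK mulmxKpV// -Ax0 trmx_mul.
    exact: submxMl.
exists x, 0, (c + Q *m x); split => //.
  by rewrite mulmx0 addr0 addrCA addNr addr0.
apply: (le_trans (norm2_col_mx_le _ _ _ _ _)).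
have := norm2D _ _ c (Q *m x).
have := HP b; have := HQ x; rewrite -/x => Qx xb.
have : KQ * norm2 x <= KQ * (KP * norm2 b) by rewrite ler_wpM2l.
have := norm2_ge0 _ _ b; have := norm2_ge0 _ _ c.
have := mulr_ge0 (addr_ge0 KP0 (mulr_ge0 KQ0 KP0)) (norm2_ge0 _ _ c).
nra.
Qed.

End NormA.

(** * Newton directions *)

Section Energy.
Variables (R : realType).

Lemma dotE p (u v : 'cV[R]_p) : (u^T *m v) 0 0 = \sum_i u i 0 * v i 0.
Proof. by rewrite mxE; apply: eq_bigr => i _; rewrite mxE. Qed.

(** The dual row is paired with [dx] and the primal row with [dy], which cancels the terms in [A];
    the squared complementarity rows, divided by [x i 0 * z i 0], supply the scaled norms and the
    cross term [dx i 0 * dz i 0]. The quadratic form of [Q] has the right sign and is dropped. *)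
Lemma energy_estimate m n (A : 'M[R]_(m, n)) (Q : 'M[R]_n) (x z dx dz rd rc : 'cV[R]_n)
    (dy rp : 'cV[R]_m) (mu : R) :
  psd Q -> (forall i, 0 < x i 0 /\ 0 < z i 0) ->
  - ((Q + mu%:M) *m dx) + A^T *m dy + dz = rd ->
  A *m dx + mu *: dy = rp ->
  (forall i, z i 0 * dx i 0 + x i 0 * dz i 0 = rc i 0) ->
  mu * (norm2 dx ^+ 2 + norm2 dy ^+ 2)
   + \sum_i (z i 0 / x i 0 * dx i 0 ^+ 2 + x i 0 / z i 0 * dz i 0 ^+ 2) / 2
  <= \sum_i rc i 0 ^+ 2 / (x i 0 * z i 0) / 2
     + norm2 dx * norm2 rd + norm2 dy * norm2 rp.
Proof.
move=> [_ Q0] xz0 hd hp hc.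
have Erc : \sum_i rc i 0 ^+ 2 / (x i 0 * z i 0) / 2 =
    \sum_i (z i 0 / x i 0 * dx i 0 ^+ 2 + x i 0 / z i 0 * dz i 0 ^+ 2) / 2
    + \sum_i dx i 0 * dz i 0.
  rewrite -big_split/=; apply: eq_bigr => i _; rewrite -hc.
  by have [x0 z0] := xz0 i; field; rewrite !gt_eqF.
have Ep : \sum_i dy i 0 * rp i 0 = (dy^T *m (A *m dx)) 0 0 + mu * norm2 dy ^+ 2.
  rewrite -dotE -hp mulmxDr mxE; congr (_ + _).
  by rewrite -scalemxAr mxE dotE norm2_sqr; under eq_bigr do rewrite -expr2.
have Ed : \sum_i dx i 0 * rd i 0 = - (dx^T *m Q *m dx) 0 0 - mu * norm2 dx ^+ 2
    + (dy^T *m (A *m dx)) 0 0 + \sum_i dx i 0 * dz i 0.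
  rewrite -!dotE -hd !mulmxDr mxE; congr (_ + _).
  rewrite mxE; congr (_ + _); last first.
    have -> : dx^T *m (A^T *m dy) = (dy^T *m (A *m dx))^T.
      by rewrite !trmx_mul trmxK mulmxA.
    by rewrite mxE.
  rewrite mulmxN mxE mulmxDl mulmxDr mxE opprD mulmxA; congr (_ + - _).
  rewrite mul_scalar_mx -scalemxAr mxE dotE norm2_sqr.
  by under eq_bigr do rewrite -expr2.
have := dot_le_norm2 _ _ dx (- 1 *: rd); rewrite norm2Z normrN1 mul1r.
under eq_bigr do rewrite mxE mulN1r mulrN; rewrite sumrN Ed.
by have := dot_le_norm2 _ _ dy rp; rewrite Ep Erc; have := Q0 dx; lra.
Qed.

End Energy.

Section NewtonStep.
Variable R : realType.

Lemma compl_muE n (x z : 'cV[R]_n) :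
  compl_mu x z = (\sum_i x i 0 * z i 0) / n%:R.
Proof. by rewrite /compl_mu dotE. Qed.

Lemma sum_compl_mu n (x z : 'cV[R]_n) : (0 < n)%N ->
  \sum_i x i 0 * z i 0 = n%:R * compl_mu x z.
Proof. by move=> n0; rewrite compl_muE mulrC divfK// pnatr_eq0 -lt0n. Qed.

Lemma compl_mu_gt0 n (x z : 'cV[R]_n) : (0 < n)%N ->
  (forall i, 0 < x i 0 /\ 0 < z i 0) -> 0 < compl_mu x z.
Proof.
move=> n0 xz0; rewrite compl_muE divr_gt0 ?ltr0n//.
rewrite (bigD1 (Ordinal n0))//= ltr_wpDr ?sumr_ge0//.
  by move=> i _; have [x0 z0] := xz0 i; rewrite mulr_ge0 ?ltW.
by have [x0 z0] := xz0 (Ordinal n0); rewrite mulr_gt0.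
Qed.

(** Averaging the linearised complementarity equations fixes the first-order change of the measure,
    so only the mean of the products [dx i 0 * dz i 0] remains unknown. *)
Lemma compl_mu_step n (x z dx dz : 'cV[R]_n) (s a : R) : (0 < n)%N ->
  (forall i, z i 0 * dx i 0 + x i 0 * dz i 0 =
     s * compl_mu x z - x i 0 * z i 0) ->
  compl_mu (x + a *: dx) (z + a *: dz) =
  compl_mu x z * (1 - a * (1 - s)) + a ^+ 2 * compl_mu dx dz.
Proof.
move=> n0 hc; have n1 : n%:R != 0 :> R by rewrite pnatr_eq0 -lt0n.
apply: (mulfI n1); rewrite -sum_compl_mu//.
have -> : \sum_i (x + a *: dx) i 0 * (z + a *: dz) i 0 =
    \sum_i x i 0 * z i 0 + a * \sum_i (s * compl_mu x z - x i 0 * z i 0) +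
    a ^+ 2 * \sum_i dx i 0 * dz i 0.
  rewrite !mulr_sumr -!big_split/=; apply: eq_bigr => i _.
  by rewrite -hc !mxE; ring.
rewrite sumrB sumr_const card_ord !sum_compl_mu// -mulr_natl.
by ring.
Qed.

(** The neighbourhood equation eliminates the iterate from the Newton right-hand side: what remains
    is the initial residual [bb], the perturbation [bt] and the proximal term [pp]. *)
Lemma newton_residual p (Ax bb bt pp b : 'cV[R]_p) (mu mu0 s : R) :
  Ax + mu *: pp = b + (mu / mu0) *: (bb + bt) ->
  (b + (s * mu / mu0) *: bb) - Ax - (s * mu) *: pp =
  (- ((1 - s) * (mu / mu0))) *: bb + (- (mu / mu0)) *: bt + ((1 - s) * mu) *: pp.
Proof.
move=> /(canRL (addrK _)) ->; apply/matrixP => i j; rewrite !mxE; ring.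
Qed.

(** The inherited perturbation shrinks by the factor [1 - a], and all new errors are of second order
    in [a]. *)
Lemma residual_step p (Ax Adx bb bt pp dy b : 'cV[R]_p) (mu mu0 s a d : R) :
  Ax + mu *: pp = b + (mu / mu0) *: (bb + bt) ->
  Adx + mu *: dy = (b + (s * mu / mu0) *: bb) - Ax - (s * mu) *: pp ->
  let mua := mu * (1 - a * (1 - s)) + a ^+ 2 * d in
  Ax + a *: Adx + mua *: (pp + a *: dy) = b + (mua / mu0) *: bb +
    (((1 - a) * (mu / mu0)) *: bt +
     a ^+ 2 *: ((- d / mu0) *: bb + d *: pp + (a * d - (1 - s) * mu) *: dy)).
Proof.
move=> h /(canRL (addrK _)) ->; move=> /=.
rewrite (newton_residual _ _ _ _ _ _ _ _ _ h).
move: h => /(canRL (addrK _)) -> /=; apply/matrixP => i j; rewrite !mxE; ring.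
Qed.

(** In the energy estimate, the linear terms in the norms of [dx] and [dy] are absorbed by half of
    the proximal quadratic terms. *)
Lemma newton_bounds m n (A : 'M[R]_(m, n)) (Q : 'M[R]_n)
    (x z dx dz rd : 'cV[R]_n) (dy rp : 'cV[R]_m) (mu mulo muhi gmu Br s : R) :
  (0 < n)%N -> psd Q -> (forall i, 0 < x i 0 /\ 0 < z i 0) ->
  mu = compl_mu x z -> 0 < mulo -> mulo <= mu <= muhi -> 0 < gmu ->
  (forall i, gmu * mu <= x i 0 * z i 0) -> 0 <= s <= 1 ->
  norm2 rd <= Br -> norm2 rp <= Br ->
  - ((Q + mu%:M) *m dx) + A^T *m dy + dz = rd ->
  A *m dx + mu *: dy = rp ->
  (forall i, z i 0 * dx i 0 + x i 0 * dz i 0 = s * mu - x i 0 * z i 0) ->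
  mulo / 2 * (norm2 dx ^+ 2 + norm2 dy ^+ 2)
   + \sum_i (z i 0 / x i 0 * dx i 0 ^+ 2 + x i 0 / z i 0 * dz i 0 ^+ 2) / 2
  <= n%:R * (muhi + muhi / gmu) + Br ^+ 2 / mulo.
Proof.
move=> n0 hQ xz0 muE mulo0 /andP[mulo_mu mu_muhi] gmu0 xzg /andP[s0 s1] rdB rpB.
move=> hd hp hc; have mu_gt0 : 0 < mu by exact: lt_le_trans mulo_mu.
have hE := energy_estimate _ _ _ A Q x z dx dz rd
  (\col_i (s * mu - x i 0 * z i 0)) dy rp mu hQ xz0 hd hp.
have {}hE := hE (fun i => ltac:(rewrite mxE; exact: hc)).
have rcE : \sum_i (\col_i (s * mu - x i 0 * z i 0)) i 0 ^+ 2 /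
    (x i 0 * z i 0) / 2 <= n%:R * (muhi + muhi / gmu).
  (* With [w = x i 0 * z i 0], the expanded square leaves at most [w + mu ^+ 2 / w], and
     [gmu * mu <= w] bounds the last quotient by [mu / gmu]. *)
  apply: (@le_trans _ _ (\sum_i (x i 0 * z i 0 + mu / gmu))).
    apply: ler_sum => i _; rewrite mxE; have [x0 z0] := xz0 i.
    have w0 : 0 < x i 0 * z i 0 by rewrite mulr_gt0.
    have wg := xzg i; set w := x i 0 * z i 0 in w0 wg *.
    rewrite ler_pdivrMr// ler_pdivrMr//.
    have smu : (s * mu) ^+ 2 <= mu ^+ 2.
      by rewrite exprMn ger_pMl ?exprn_gt0// expr_le1.
    have : mu ^+ 2 <= mu / gmu * w.
      by rewrite -mulrA expr2 ler_wpM2l ?(ltW mu_gt0)// [leRHS]mulrC ler_pdivlMr// mulrC.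
    have : 0 <= s * mu * w by rewrite !mulr_ge0// ltW.
    have : 0 < w ^+ 2 by rewrite exprn_gt0.
    have : 0 <= mu / gmu * w by rewrite !mulr_ge0 ?invr_ge0// ltW.
    nra.
  rewrite big_split/= sum_compl_mu// -muE sumr_const card_ord -[_ / _ *+ n]mulr_natl -mulrDr.
  by rewrite ler_wpM2l// lerD// ler_wpM2r// invr_ge0 ltW.
have Br0 : 0 <= Br by exact: le_trans (norm2_ge0 _ _ rd) rdB.
(* AM-GM on [t * Br] *)
have young (t : R) : 0 <= t -> t * Br <= mu / 2 * t ^+ 2 + Br ^+ 2 / mulo / 2.
  move=> t0.
  have : 0 <= (mulo * t - Br) ^+ 2 / mulo / 2 by rewrite !divr_ge0 ?sqr_ge0// ltW.
  have -> : (mulo * t - Br) ^+ 2 / mulo / 2 =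
      mulo / 2 * t ^+ 2 + Br ^+ 2 / mulo / 2 - t * Br.
    by field; rewrite gt_eqF.
  have : mulo / 2 * t ^+ 2 <= mu / 2 * t ^+ 2.
    by rewrite ler_wpM2r ?sqr_ge0//; lra.
  lra.
have := young _ (norm2_ge0 _ _ dx); have := young _ (norm2_ge0 _ _ dy).
have : norm2 dx * norm2 rd <= norm2 dx * Br by rewrite ler_wpM2l ?norm2_ge0.
have : norm2 dy * norm2 rp <= norm2 dy * Br by rewrite ler_wpM2l ?norm2_ge0.
have : mulo / 2 * (norm2 dx ^+ 2 + norm2 dy ^+ 2) <=
    mu / 2 * (norm2 dx ^+ 2 + norm2 dy ^+ 2).
  by rewrite ler_wpM2r ?addr_ge0 ?sqr_ge0//; lra.
lra.
Qed.

End NewtonStep.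

Ltac nonneg := repeat first
  [ assumption | exact: norm2_ge0 | exact: sqr_ge0 | apply: ltW; assumption
  | match goal with
    | |- is_true (Order.le _ (_ + _)) => apply: addr_ge0
    | |- is_true (Order.le _ (_ / _)) => apply: divr_ge0
    | |- is_true (Order.le _ (_ * _)) => apply: mulr_ge0
    end
  | done ].

(** * Scalar inequalities for short steps *)

Section Scalar.
Variable R : realType.

Lemma small_factor (T : R) (S : seq R) : 0 < T -> all (fun s => 0 < s) S ->
  exists a : R, 0 < a <= 1 /\ all (fun s => a * T < s) S.
Proof.
move=> T0; elim: S => [|s S IHS] /=; first by exists 1; rewrite ltr01 lexx.
move=> /andP[s0 /IHS[a [/andP[a0 a1] aS]]].
exists (Num.min a (s / (2 * T))); split.
  by rewrite lt_min a0 divr_gt0 ?mulr_gt0//= ge_min a1.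
apply/andP; split.
  rewrite -ltr_pdivlMr// gt_min ltr_pM2l//; apply/orP; right.
  by rewrite ltf_pV2 ?posrE ?mulr_gt0//; lra.
apply: sub_all aS => t; apply: le_lt_trans.
by rewrite ler_wpM2r ?(ltW T0)// ge_min lexx.
Qed.

(* The budget [C] on the perturbation grows by at least [a * s * mu / M * C]
   relative to the inherited part, while the new error is of order [a ^+ 2]. *)
Lemma budget_step (mu mulo M a s smin d E C N : R) :
  0 < M -> 0 < mulo <= mu -> 0 < a <= 1 -> smin <= s -> 0 < smin ->
  `|d| <= E -> 0 <= C -> 0 <= N ->
  a * (N + C * E / M) <= C * smin * mulo / M ->
  (1 - a) * (mu / M) * C + a ^+ 2 * N <=
  (mu * (1 - a * (1 - s)) + a ^+ 2 * d) / M * C.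
Proof.
move=> M0 /andP[mulo0 mulomu] /andP[a0 a1] smins smin0.
rewrite ler_norml => /andP[dE _] C0 N0 aN.
have h1 : smin * mulo <= s * mu by rewrite ler_pM// ltW.
have h2 : C / M * (smin * mulo) <= C / M * (s * mu).
  by rewrite ler_wpM2l// divr_ge0// ltW.
have h3 : a * (a * (N + C * E / M)) <= a * (C / M * (s * mu)).
  rewrite ler_wpM2l ?(ltW a0)// (le_trans aN)// (le_trans _ h2)//.
  by rewrite le_eqVlt; apply/orP; left; apply/eqP; ring.
have h4 : (a ^+ 2 * C / M) * (- E) <= (a ^+ 2 * C / M) * d.
  by rewrite ler_wpM2l// divr_ge0 ?mulr_ge0 ?sqr_ge0// ltW.
have -> : (mu * (1 - a * (1 - s)) + a ^+ 2 * d) / M * C =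
  (1 - a) * (mu / M) * C + a * (C / M * (s * mu)) + (a ^+ 2 * C / M) * d by ring.
have e3 : a * (a * (N + C * E / M)) = a ^+ 2 * N - (a ^+ 2 * C / M) * (- E) by ring.
lra.
Qed.

Lemma le_of_sqr_bound (c t E : R) :
  0 < c -> c / 2 * t ^+ 2 <= E -> t <= 2 * E / c + 1.
Proof.
move=> c0 tE; have t2 : t ^+ 2 <= 2 * E / c by rewrite ler_pdivlMr//; lra.
have := sqr_ge0 t; have := sqr_ge0 (t - 1); rewrite sqrrB mulr1 expr1n -mulr_natl; lra.
Qed.

Lemma norm_mul_le_scaled (u v du dv : R) : 0 < u -> 0 < v ->
  `|du * dv| <= (v / u * du ^+ 2 + u / v * dv ^+ 2) / 2.
Proof.
move=> u0 v0.
have p1 : 0 <= (v * du - u * dv) ^+ 2 / (u * v) by nonneg; apply: mulr_gt0.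
have p2 : 0 <= (v * du + u * dv) ^+ 2 / (u * v) by nonneg; apply: mulr_gt0.
have e1 : (v * du - u * dv) ^+ 2 / (u * v) =
    v / u * du ^+ 2 + u / v * dv ^+ 2 - 2 * (du * dv).
  by field; rewrite !gt_eqF.
have e2 : (v * du + u * dv) ^+ 2 / (u * v) =
    v / u * du ^+ 2 + u / v * dv ^+ 2 + 2 * (du * dv).
  by field; rewrite !gt_eqF.
by rewrite ler_norml; lra.
Qed.

Lemma sqr_mul_norm_le (a t E : R) : 0 <= a -> `|t| <= E ->
  - (a * (a * E)) <= a ^+ 2 * t <= a * (a * E).
Proof.
move=> a0 tE; rewrite -ler_norml normrM ger0_norm ?sqr_ge0// mulrA -expr2.
by rewrite ler_wpM2l ?sqr_ge0.
Qed.

(** Newton pulls each product towards [s * mu], leaving a first-order surplus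
    [a * (1 - gmu) * s * mu] over the centrality threshold; the second-order terms cost at most
    [2 * a ^+ 2 * E]. *)
Lemma product_step (gmu mu mulo s smin a E d u v du dv : R) :
  0 < gmu < 1 -> 0 < a <= 1 -> smin * mulo <= s * mu ->
  `|d| <= E -> `|du * dv| <= E -> gmu * mu <= u * v ->
  v * du + u * dv = s * mu - u * v ->
  a * (2 * E) <= smin * (1 - gmu) * mulo ->
  gmu * (mu * (1 - a * (1 - s)) + a ^+ 2 * d) <= (u + a * du) * (v + a * dv).
Proof.
move=> /andP[g0 g1] /andP[a0 a1] smm dE qE uvg hc aE.
have E0 : 0 <= E by exact: le_trans dE.
have -> : (u + a * du) * (v + a * dv) =
    (1 - a) * (u * v) + a * (s * mu) + a ^+ 2 * (du * dv).
  have -> : a * (s * mu) = a * (v * du + u * dv) + a * (u * v) by rewrite hc; ring.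
  by ring.
have h1 : (1 - a) * (gmu * mu) <= (1 - a) * (u * v).
  by rewrite ler_wpM2l//; lra.
have /andP[h2 _] := sqr_mul_norm_le _ _ _ (ltW a0) qE.
have /andP[_ a2d] := sqr_mul_norm_le _ _ _ (ltW a0) dE.
have h3 : gmu * (a ^+ 2 * d) <= a * (a * E).
  apply: (@le_trans _ _ (gmu * (a * (a * E)))); first by rewrite ler_wpM2l// ltW.
  by apply: ler_piMl; [nonneg|exact: ltW].
have h4 : a * (2 * (a * E)) <= a * ((1 - gmu) * (s * mu)).
  rewrite ler_wpM2l ?(ltW a0)//.
  have : (1 - gmu) * (smin * mulo) <= (1 - gmu) * (s * mu).
    by rewrite ler_wpM2l//; lra.
  lra.
lra.
Qed.

(** As [1 - s >= 1 / 2], the first-order decrease is at least [a * mu / 2], of which the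
    second-order term takes back at most [a * mu / 8]. *)
Lemma mu_step_le (mu mulo s a E d : R) :
  0 < mulo <= mu -> s <= 1 / 2%:R -> 0 < a <= 1 -> `|d| <= E ->
  a * (2 * E) <= mulo / 4%:R ->
  mu * (1 - a * (1 - s)) + a ^+ 2 * d <= (1 - a / 100%:R) * mu.
Proof.
move=> /andP[mulo0 mulomu] s12 /andP[a0 a1] dE aE.
have mu0 : 0 < mu by exact: lt_le_trans mulomu.
have /andP[_ a2d] := sqr_mul_norm_le _ _ _ (ltW a0) dE.
have h1 : a * (a * E) <= a * (mu / 8) by rewrite ler_wpM2l ?(ltW a0)//; lra.
have h2 : a * (s * mu) <= a * (1 / 2%:R * mu).
  by rewrite ler_wpM2l ?(ltW a0)// ler_wpM2r// ltW.
have h3 : 0 < a * mu by exact: mulr_gt0.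
lra.
Qed.

(** A sign change would force [u ^+ 2 <= a ^+ 2 * du ^+ 2]; multiplied by [v / u], this puts [u * v]
    below [w]. *)
Lemma component_step_gt0 (w a E u v du dv : R) : 0 < u -> 0 < v ->
  w <= u * v -> v / u * du ^+ 2 + u / v * dv ^+ 2 <= 2 * E ->
  0 < a <= 1 -> a * (2 * E) < w -> 0 < u + a * du.
Proof.
move=> u0 v0 uvg uvE /andP[a0 a1] aE; rewrite ltNge; apply/negP => h.
have h1 : u ^+ 2 <= a ^+ 2 * du ^+ 2.
  by rewrite -exprMn -(sqrrN (a * du)) ler_sqr ?nnegrE; lra.
have h2 : v / u * u ^+ 2 <= v / u * (a ^+ 2 * du ^+ 2).
  by rewrite ler_wpM2l// divr_ge0// ltW.
have e2 : v / u * u ^+ 2 = u * v by field; rewrite gt_eqF.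
have h3 : 0 <= u / v * dv ^+ 2 by nonneg.
have h3' : 0 <= v / u * du ^+ 2 by nonneg.
have h4 : a ^+ 2 * (v / u * du ^+ 2) <= a ^+ 2 * (2 * E).
  by rewrite ler_wpM2l ?sqr_ge0//; lra.
have h5 : a ^+ 2 * (2 * E) <= a * (2 * E).
  rewrite expr2 -mulrA; apply: ler_piMl => //.
  by rewrite mulr_ge0 ?(ltW a0)//; lra.
lra.
Qed.

Lemma mixing_coef_le (a d s mu M E : R) :
  0 < a <= 1 -> `|d| <= E -> 0 <= s <= 1 -> 0 <= mu <= M ->
  `|a * d - (1 - s) * mu| <= E + M.
Proof.
move=> /andP[a0 a1] dE /andP[s0 s1] /andP[m0 mM].
apply: (le_trans (ler_normB _ _)); rewrite !normrM (gtr0_norm a0).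
rewrite (ger0_norm m0) (@ger0_norm _ (1 - s)) ?subr_ge0//.
apply: lerD; first by apply: le_trans dE; exact: ler_piMl.
by apply: le_trans mM; apply: ler_piMl => //; lra.
Qed.

End Scalar.

(** * Uniform bounds on Newton directions, and the range of [A] *)

Definition in_range (R : realType) m n (A : 'M[R]_(m, n)) (u : 'cV[R]_m) : Prop :=
  exists w, A *m w = u.
Arguments in_range {R m n} A u.

Section Uniform.
Variable R : realType.

Lemma mu0_gt0 n (rho : R) : (0 < n)%N -> 0 < rho -> 0 < mu0 n rho.
Proof.
move=> n0 rho0; apply: compl_mu_gt0 => // i.
by rewrite !mxE mulr1.
Qed.

(** The dual row is brought to the shape of the primal one, with proximal term [- (x - zeta)] and
    direction [- dx], so that the residual lemmas serve for both. *)
Lemma newtonP m n (A : 'M[R]_(m, n)) (Q : 'M[R]_n) b c rho y0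
    (x : 'cV[R]_n) (y : 'cV[R]_m) z zeta lam s dx dy dz :
  let mu := compl_mu x z in let th := s * mu / mu0 n rho in
  newton A Q b c rho y0 (State x y z zeta lam) s dx dy dz ->
  [/\ (- (Q *m dx) + A^T *m dy + dz) + mu *: - dx =
        (c + th *: cbar A Q c rho y0) - (- (Q *m x) + A^T *m y + z)
        - (s * mu) *: - (x - zeta),
      A *m dx + mu *: dy =
        (b + th *: bbar A b rho) - A *m x - (s * mu) *: (y - lam) &
      forall i, z i 0 * dx i 0 + x i 0 * dz i 0 = s * mu - x i 0 * z i 0].
Proof.
move=> /= [nd np nc]; split => //.
  have -> : (- (Q *m dx) + A^T *m dy + dz) + compl_mu x z *: - dx =
      - ((Q + (compl_mu x z)%:M) *m dx) + A^T *m dy + dz.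
    rewrite mulmxDl mul_scalar_mx; set v1 := Q *m _; set v2 := _ *m dy.
    by apply/matrixP => i j; rewrite !mxE; ring.
  rewrite nd; set v1 := Q *m _; set v2 := _ *m y.
  set cb := cbar _ _ _ _ _; set mu := compl_mu _ _; set mu0 := mu0 _ _.
  by apply/matrixP => i j; rewrite !mxE; ring.
move=> i; have := congr1 (fun v : 'cV[R]_n => v i 0) nc.
have wE : (dg x *m dg z *m ones) i 0 = x i 0 * z i 0.
  by rewrite -mulmxA !dgE mxE mulr1.
rewrite mxE !dgE => ->; rewrite mxE [X in X + _]mxE wE mxE [ones _ _]mxE.
by rewrite mulr1 addrC.
Qed.

(* The bound does not involve the size of the iterate, only that of the
   proximal terms. *)
Lemma newton_direction_bounded m n (A : 'M[R]_(m, n)) (Q : 'M[R]_n)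
    (b bb : 'cV[R]_m) (c cb : 'cV[R]_n) (CN gmu mulo M B : R) :
  (0 < n)%N -> psd Q -> 0 < CN -> 0 < gmu -> 0 < mulo -> 0 < M -> 0 <= B ->
  exists2 E : R, 0 <= E &
  forall (x : 'cV[R]_n) (y : 'cV[R]_m) z p q s dx dy dz bt ct,
  let mu := compl_mu x z in
  mulo <= mu <= M -> 0 <= s <= 1 -> (forall i, 0 < x i 0 /\ 0 < z i 0) ->
  (forall i, gmu * mu <= x i 0 * z i 0) -> norm2 p <= B -> norm2 q <= B ->
  norm2 bt <= CN -> norm2 ct <= CN ->
  A *m x + mu *: p = b + (mu / M) *: (bb + bt) ->
  - (Q *m x) + A^T *m y + z + mu *: q = c + (mu / M) *: (cb + ct) ->
  (- (Q *m dx) + A^T *m dy + dz) + mu *: - dx =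
    (c + (s * mu / M) *: cb) - (- (Q *m x) + A^T *m y + z) - (s * mu) *: q ->
  A *m dx + mu *: dy =
    (b + (s * mu / M) *: bb) - A *m x - (s * mu) *: p ->
  (forall i, z i 0 * dx i 0 + x i 0 * dz i 0 = s * mu - x i 0 * z i 0) ->
  [/\ `|compl_mu dx dz| <= E,
      forall i, z i 0 / x i 0 * dx i 0 ^+ 2 + x i 0 / z i 0 * dz i 0 ^+ 2 <= 2 * E,
      norm2 dx <= 2 * E / mulo + 1 &
      norm2 dy <= 2 * E / mulo + 1].
Proof.
move=> n0 hQ CN0 gmu0 mulo0 M0 B0.
have n1 : 1 <= n%:R :> R by rewrite ler1n.
(* Bounds both Newton right-hand sides: since [mu <= M], the coefficients of the initial residual
   and of the perturbation are at most 1, and that of the proximal term at most [M]. *)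
pose Br : R := norm2 bb + norm2 cb + CN + M * B.
pose E : R := n%:R * (M + M / gmu) + Br ^+ 2 / mulo.
have E0 : 0 <= E by rewrite /E; nonneg.
exists E => // x y z p q s dx dy dz bt ct mu mulomuM s01 xz0 xzg pB qB btB ctB.
move=> hp hd nd np hc; have muE : mu = compl_mu x z by []; clearbody mu.
have /andP[mulomu muM] := mulomuM; have /andP[s0 s1] := s01.
have mu_gt0 : 0 < mu by exact: lt_le_trans mulomu.
have th1 : mu / M <= 1 by rewrite ler_pdivrMr// mul1r.
have th0 : 0 < mu / M by rewrite divr_gt0.
have rhsB k (b1 t1 p1 : 'cV[R]_k) : norm2 b1 <= norm2 bb + norm2 cb ->
    norm2 t1 <= CN -> norm2 p1 <= B ->
    norm2 ((- ((1 - s) * (mu / M))) *: b1 + (- (mu / M)) *: t1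
      + ((1 - s) * mu) *: p1) <= Br.
  move=> b1B t1B p1B.
  have s2 : 0 <= 1 - s by rewrite subr_ge0.
  have s3 : 1 - s <= 1 by rewrite lerBlDr lerDl.
  apply: (le_trans (norm2D _ _ _ _)); apply: lerD; last first.
    rewrite norm2Z ger0_norm ?mulr_ge0 ?(ltW mu_gt0)//.
    apply: ler_pM => //; [by nonneg|exact: norm2_ge0|].
    by apply: le_trans muM; rewrite ger_pMl.
  apply: (le_trans (norm2D _ _ _ _)); apply: lerD.
    have c0 : 0 <= (1 - s) * (mu / M) by apply: mulr_ge0 => //; exact: ltW.
    rewrite norm2Z normrN ger0_norm//.
    apply: le_trans b1B; rewrite -[leRHS]mul1r ler_wpM2r ?norm2_ge0//.
    by rewrite mulr_ile1 ?(ltW th0).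
  rewrite norm2Z normrN ger0_norm ?(ltW th0)//.
  by apply: le_trans t1B; rewrite -[leRHS]mul1r ler_wpM2r ?norm2_ge0.
have bbB : norm2 bb <= norm2 bb + norm2 cb by rewrite lerDl norm2_ge0.
have cbB : norm2 cb <= norm2 bb + norm2 cb by rewrite lerDr norm2_ge0.
have rpB := rhsB _ _ _ _ bbB btB pB.
have rdB := rhsB _ _ _ _ cbB ctB qB.
rewrite -(newton_residual _ _ _ _ _ _ _ _ _ _ hp) -np in rpB.
rewrite -(newton_residual _ _ _ _ _ _ _ _ _ _ hd) -nd in rdB.
have ndE : - ((Q + mu%:M) *m dx) + A^T *m dy + dz =
    (- (Q *m dx) + A^T *m dy + dz) + mu *: - dx.
  rewrite mulmxDl mul_scalar_mx; set v1 := Q *m _; set v2 := _ *m dy.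
  by apply/matrixP => i j; rewrite !mxE; ring.
have := newton_bounds _ _ _ A Q x z dx dz _ dy _ mu mulo M gmu Br s n0 hQ xz0
  muE mulo0 mulomuM gmu0 xzg s01 rdB rpB ndE erefl hc.
rewrite -/E; set S := \sum_(_ | _) _ => bnd.
have dsum_ge0 i : 0 <= (z i 0 / x i 0 * dx i 0 ^+ 2 + x i 0 / z i 0 * dz i 0 ^+ 2) / 2.
  by have [x0 z0] := xz0 i; nonneg.
have S0 : 0 <= S by apply: sumr_ge0.
have dx0 : 0 <= mulo / 2 * norm2 dx ^+ 2 by nonneg.
have dy0 : 0 <= mulo / 2 * norm2 dy ^+ 2 by nonneg.
rewrite mulrDr in bnd.
have SE : S <= E by apply: le_trans bnd; rewrite lerDr addr_ge0.
split.
- rewrite compl_muE normrM normfV normr_nat ler_pdivrMr ?ltr0n//.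
  apply: (@le_trans _ _ E); last by rewrite ler_peMr.
  apply: le_trans SE; apply: (le_trans (ler_norm_sum _ _ _)).
  by apply: ler_sum => i _; have [x0 z0] := xz0 i; exact: norm_mul_le_scaled.
- move=> i; rewrite [leRHS]mulrC -ler_pdivrMr//; apply: le_trans SE.
  by rewrite /S (bigD1 i)//= lerDl; apply: sumr_ge0.
- apply: le_of_sqr_bound => //; apply: le_trans bnd.
  by rewrite -addrA lerDl addr_ge0.
- apply: le_of_sqr_bound => //; apply: le_trans bnd.
  by rewrite addrAC lerDr addr_ge0.
Qed.

Lemma in_rangeD m n (A : 'M[R]_(m, n)) u v :
  in_range A u -> in_range A v -> in_range A (u + v).
Proof. by move=> [w <-] [w' <-]; exists (w + w'); rewrite mulmxDr. Qed.

Lemma in_rangeZ m n (A : 'M[R]_(m, n)) t u : in_range A u -> in_range A (t *: u).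
Proof. by move=> [w <-]; exists (t *: w); rewrite scalemxAr. Qed.

Lemma in_rangeN m n (A : 'M[R]_(m, n)) u : in_range A u -> in_range A (- u).
Proof. by rewrite -scaleN1r; exact: in_rangeZ. Qed.

Lemma in_rangeM m n (A : 'M[R]_(m, n)) w : in_range A (A *m w).
Proof. by exists w. Qed.

Lemma in_range_proximal m n (A : 'M[R]_(m, n)) (v u r : 'cV[R]_m) mu :
  mu != 0 -> in_range A v -> v + mu *: u = r -> in_range A r -> in_range A u.
Proof.
move=> mu0 vA vur rA.
have -> : u = mu^-1 *: (r - v) by rewrite -vur addrAC subrr add0r scalerK.
by apply: in_rangeZ; apply: in_rangeD => //; exact: in_rangeN.
Qed.

End Uniform.

(** * Step lengths *)

Section UniformStep.
Variable R : realType.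

Lemma perturbation_le p (a d s mu M E B W : R) (b1 p1 d1 : 'cV[R]_p) :
  0 < M -> 0 < a <= 1 -> `|d| <= E -> 0 <= s <= 1 -> 0 <= mu <= M ->
  norm2 p1 <= B -> norm2 d1 <= W ->
  norm2 ((- d / M) *: b1 + d *: p1 + (a * d - (1 - s) * mu) *: d1) <=
  E / M * norm2 b1 + E * B + (E + M) * W.
Proof.
move=> M0 a01 dE s01 muM p1B d1W.
apply: (le_trans (norm2D _ _ _ _)); apply: lerD; last first.
  by rewrite norm2Z; apply: ler_pM => //; [exact: norm2_ge0|exact: mixing_coef_le].
apply: (le_trans (norm2D _ _ _ _)); apply: lerD; last first.
  by rewrite norm2Z; apply: ler_pM => //; exact: norm2_ge0.
rewrite norm2Z normrM normfV normrN (gtr0_norm M0).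
by rewrite ler_wpM2r ?norm2_ge0// ler_wpM2r// invr_ge0 ltW.
Qed.

(* Without [b] in the range of [A], the perturbation of a step would have
   infinite [normA]. *)
Lemma uniform_admissible_step m n (A : 'M[R]_(m, n)) (Q : 'M[R]_n)
    (b : 'cV[R]_m) (c : 'cV[R]_n) (rho : R) (y0 : 'cV[R]_m)
    (CN gA gmu smin mulo B : R) :
  (0 < n)%N -> psd Q -> 0 < rho -> 0 < CN -> 0 < gA -> 0 < gmu < 1 ->
  0 < smin -> 0 < mulo -> in_range A b ->
  exists2 a : R, 0 < a &
  forall x y z zeta lam s dx dy dz,
  let mu := compl_mu x z in
  mulo <= mu <= mu0 n rho -> smin <= s <= 1 / 2%:R ->
  norm2 (y - lam) <= B -> norm2 (x - zeta) <= B ->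
  nbhd A Q b c rho y0 CN gA gmu mu zeta lam x y z ->
  newton A Q b c rho y0 (State x y z zeta lam) s dx dy dz ->
  admissible_step A Q b c rho y0 CN gA gmu (State x y z zeta lam) dx dy dz a.
Proof.
move=> n0 hQ rho0 CN0 gA0 gmu01 smin0 mulo0 rngb.
have /andP[gmu0 gmu1] := gmu01.
have M0 := mu0_gt0 _ _ _ n0 rho0.
have [M ME] : exists M, M = mu0 n rho by exists (mu0 n rho).
rewrite -ME in M0 *; set bb := bbar A b rho; set cb := cbar A Q c rho y0.
have [B0|B0] := ltP B 0.
  (* A negative [B] bounds no norm, so the claim is vacuous. *)
  exists 1 => // x y z zeta lam s dx dy dz mu _ _ /le_lt_trans/(_ B0).
  by rewrite ltNge norm2_ge0.
have [K K0 HK] := normA_bounded _ _ _ A Q.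
have [E E0 HE] := newton_direction_bounded _ _ _ A Q b bb c cb CN gmu mulo M B
  n0 hQ CN0 gmu0 mulo0 M0 B0.
pose W : R := 2 * E / mulo + 1.
pose Ne : R := (E / M * norm2 bb + E * B + (E + M) * W) +
  (E / M * norm2 cb + E * B + (E + M) * W).
have W0 : 0 <= W by rewrite /W; nonneg.
have Ne0 : 0 <= Ne by rewrite /Ne; nonneg.
(* [T] dominates every quantity that [a] must make small, so one product [a * T] is compared with
   all thresholds; the final 1 makes [T] positive. *)
pose T : R := 2 * E + (Ne + CN * E / M) + (K * Ne + gA * rho * E / M) + 1.
have gr0 : 0 < gA * rho by rewrite mulr_gt0.
have T1 : 0 <= Ne + CN * E / M by nonneg.
have T2 : 0 <= K * Ne + gA * rho * E / M by nonneg.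
have T3 : 0 <= 2 * E by nonneg.
(* Thresholds in order: positivity of the iterate, decrease of [mu], centrality, and the two budgets
   on the perturbation, in Euclidean norm and in semi-norm. *)
have [||a [a01]] := small_factor _ T [:: gmu * mulo; mulo / 4%:R;
    smin * (1 - gmu) * mulo; CN * smin * mulo / M; gA * rho * smin * mulo / M].
- by rewrite /T; apply: ltr_wpDl => //; nonneg.
- by rewrite /=; do ?[apply/andP; split | apply: divr_gt0 | apply: mulr_gt0];
    rewrite ?subr_gt0.
move=> /and5P[aT1 aT2 aT3 aT4 /andP[aT5 _]].
have /andP[a0 a1] := a01.
have aTle t : t <= T -> a * t <= a * T by move=> tT; rewrite ler_wpM2l// ltW.
have aE : a * (2 * E) <= a * T.
  by apply: aTle; rewrite /T -!addrA lerDl; nonneg.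
have aN1 : a * (Ne + CN * E / M) <= a * T.
  by apply: aTle; rewrite /T; lra.
have aN2 : a * (K * Ne + gA * rho * E / M) <= a * T.
  by apply: aTle; rewrite /T addrAC lerDr; nonneg.
clearbody T.
exists a => // x y z zeta lam s dx dy dz mu mulomuM /andP[smins s12] yB xB.
have /andP[mulomu muM] := mulomuM.
case=> xz0 xzg [bt [ct [btct nbtct hp hd]]] /newtonP.
rewrite -ME -/bb -/cb -/mu in hp hd *; case=> nd np hc.
have s0 : 0 < s by exact: lt_le_trans smins.
have s01 : 0 <= s <= 1 by rewrite ltW// (le_trans s12)// ler_pdivrMr// mul1r ler1n.
have mu_gt0 : 0 < mu by exact: lt_le_trans mulomu.
have mu0M : 0 <= mu <= M by rewrite ltW.
have btB : norm2 bt <= CN by exact: le_trans (norm2_le_col_mxl _ _ _ _ _) btct.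
have ctB : norm2 ct <= CN by exact: le_trans (norm2_le_col_mxr _ _ _ _ _) btct.
have qB : norm2 (- (x - zeta)) <= B by rewrite -scaleN1r norm2Z normrN1 mul1r.
rewrite -[- (mu *: _)]scalerN in hd.
have [dE termE dxW dyW] := HE _ _ _ _ _ _ _ _ _ _ _ mulomuM s01 xz0 xzg yB qB
  btB ctB hp hd nd np hc.
have muaE := compl_mu_step R n x z dx dz s a n0 hc.
have muE : mu = compl_mu x z by []; clearbody mu; rewrite -?muE in muaE *.
set d := compl_mu dx dz in dE muaE; clearbody d.
have pos_step i : 0 < (x + a *: dx) i 0 /\ 0 < (z + a *: dz) i 0.
  have [x0 z0] := xz0 i; have := xzg i; have := termE i; rewrite !mxE => tE gE.
  have gE' : gmu * mulo <= x i 0 * z i 0.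
    by apply: le_trans gE; rewrite ler_wpM2l// ltW.
  have aE' := le_lt_trans aE aT1.
  split; first exact: component_step_gt0 gE' tE a01 aE'.
  rewrite [leRHS]mulrC in gE'; rewrite addrC in tE.
  exact: component_step_gt0 gE' tE a01 aE'.
have prodE i : gmu * (mu * (1 - a * (1 - s)) + a ^+ 2 * d) <=
    (x + a *: dx) i 0 * (z + a *: dz) i 0.
  have [x0 z0] := xz0 i.
  rewrite ![(_ + _ : 'cV[R]_n) _ _]mxE ![(_ *: _ : 'cV[R]_n) _ _]mxE.
  apply: (@product_step _ _ _ mulo s smin _ E) => //.
  - by apply: ler_pM => //; exact: ltW.
  - apply: (le_trans (norm_mul_le_scaled _ _ _ _ _ x0 z0)).
    by rewrite ler_pdivrMr// [leRHS]mulrC; exact: termE.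
  - exact: le_trans aE (ltW aT3).
have mua0 := compl_mu_gt0 _ _ _ _ n0 pos_step.
rewrite muaE in mua0.
(* [eb] and [ec] are the second-order errors of the primal and dual rows, without the factor
   [a ^+ 2]. *)
pose eb := (- d / M) *: bb + d *: (y - lam) + (a * d - (1 - s) * mu) *: dy.
pose ec := (- d / M) *: cb + d *: - (x - zeta) + (a * d - (1 - s) * mu) *: - dx.
have dxW' : norm2 (- dx) <= W by rewrite -scaleN1r norm2Z normrN1 mul1r.
have ebB : norm2 eb <= E / M * norm2 bb + E * B + (E + M) * W.
  exact: perturbation_le.
have ecB : norm2 ec <= E / M * norm2 cb + E * B + (E + M) * W.
  exact: perturbation_le.
have ebcB : norm2 eb + norm2 ec <= Ne by exact: lerD.
have rngbb : in_range A bb.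
  by apply: in_rangeD; [exact: in_rangeM|exact: in_rangeN].
have mun0 : mu != 0 by rewrite gt_eqF.
have rngp : in_range A (y - lam).
  apply: in_range_proximal hp _ => //; first exact: in_rangeM.
  apply: in_rangeD => //; apply: in_rangeZ; apply: in_rangeD => //.
  exact: normA_range nbtct.
have rngdy : in_range A dy.
  apply: in_range_proximal np _ => //; first exact: in_rangeM.
  apply: in_rangeD; last by apply: in_rangeN; exact: in_rangeZ.
  apply: in_rangeD; last by apply: in_rangeN; exact: in_rangeM.
  by apply: in_rangeD => //; exact: in_rangeZ.
have rngeb : in_range A eb.
  by apply: in_rangeD; [apply: in_rangeD; exact: in_rangeZ|exact: in_rangeZ].
have ebcA : (normA A Q eb ec <= (K * Ne)%:E)%E.
  by apply: (le_trans (HK _ _ rngeb)); rewrite lee_fin ler_wpM2l.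
have mulomu' : 0 < mulo <= mu by rewrite mulo0.
set mua := mu * (1 - a * (1 - s)) + a ^+ 2 * d in muaE mua0 prodE.
have bud1 : (1 - a) * (mu / M) * CN + a ^+ 2 * Ne <= mua / M * CN.
  apply: (@budget_step R mu mulo M a s smin d E) => //; first exact: ltW.
  exact: le_trans aN1 (ltW aT4).
have bud2 : (1 - a) * (mu / M) * (gA * rho) + a ^+ 2 * (K * Ne) <=
    mua / M * (gA * rho).
  apply: (@budget_step R mu mulo M a s smin d E) => //.
  - exact: ltW.
  - by nonneg.
  - exact: le_trans aN2 (ltW aT5).
split; rewrite -?muE ?muaE//.
  by apply: (@mu_step_le _ _ mulo _ _ E) => //; exact: le_trans aE (ltW aT2).
split=> //; rewrite -ME -/bb -/cb.
have th0 : 0 < mu / M by rewrite divr_gt0.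
have tha0 : 0 < mua / M by rewrite divr_gt0.
(* The neighbourhood multiplies its perturbation by [mua / M], so the total error is divided by this
   ratio to obtain the witnesses. *)
pose t := (mua / M)^-1; have t0 : 0 < t by rewrite invr_gt0.
have tmua : mua / M * t = 1 by rewrite mulfV// gt_eqF.
have c0 : 0 <= (1 - a) * (mu / M) by rewrite mulr_ge0 ?subr_ge0 ?(ltW th0).
have hpa := residual_step _ _ _ _ _ _ _ _ _ _ _ _ a d hp np.
have hda := residual_step _ _ _ _ _ _ _ _ _ _ _ _ a d hd nd.
rewrite /= -/mua -/eb in hpa; rewrite /= -/mua -/ec in hda; clearbody mua eb ec.
exists (t *: (((1 - a) * (mu / M)) *: bt + a ^+ 2 *: eb)),
  (t *: (((1 - a) * (mu / M)) *: ct + a ^+ 2 *: ec)); split.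
- rewrite -scale_col_mx -add_col_mx -!scale_col_mx norm2Z gtr0_norm//.
  rewrite mulrC ler_pdivrMr// [leRHS]mulrC; apply: le_trans bud1.
  apply: (le_trans (norm2D _ _ _ _)); rewrite !norm2Z !ger0_norm ?sqr_ge0//.
  apply: lerD; first by rewrite ler_wpM2l.
  rewrite ler_wpM2l ?sqr_ge0//; exact: le_trans (norm2_col_mx_le _ _ _ _ _) ebcB.
- apply: (@le_trans _ _ (t * ((1 - a) * (mu / M) * (gA * rho)
      + a ^+ 2 * (K * Ne)))%:E).
    apply: normAZ_le; first exact: ltW.
    by apply: normAD_le; apply: normAZ_le => //; exact: sqr_ge0.
  by rewrite lee_fin mulrC ler_pdivrMr// [leRHS]mulrC.
- rewrite [in RHS]scalerDr [in RHS]scalerA tmua scale1r [in RHS]addrA -hpa.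
  by rewrite mulmxDr scalemxAr [y - lam + _]addrAC.
- rewrite [in RHS]scalerDr [in RHS]scalerA tmua scale1r [in RHS]addrA -hda.
  rewrite !mulmxDr -!scalemxAr.
  set v1 := Q *m x; set v2 := Q *m dx; set v3 := _ *m y; set v4 := _ *m dy.
  by apply/matrixP => i j; rewrite !mxE; ring.
Qed.
End UniformStep.

(** * Runs of the algorithm *)

Section Run.
Variable R : realType.

Lemma mu0E n (rho : R) : (0 < n)%N -> mu0 n rho = rho ^+ 2.
Proof.
move=> n0; rewrite /mu0 compl_muE.
under eq_bigr do rewrite !mxE mulr1.
by rewrite sumr_const card_ord -[_ *+ n]mulr_natr mulfK ?expr2// pnatr_eq0 -lt0n.
Qed.

(* At the perfectly centred starting point AM-GM gives
   [compl_mu dx dz <= (1 - s) ^+ 2 * mu0 / 4], which makes the scalar [t] below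
   positive; since [t *: bbar] is in the range of [A], so is [b]. *)
Lemma first_step_range m n (A : 'M[R]_(m, n)) (Q : 'M[R]_n) b c rho y0
    CN gA gmu s dx dy dz a :
  (0 < n)%N -> 0 < rho -> s <= 1 / 2%:R -> 0 < s ->
  newton A Q b c rho y0 (init_state n rho y0) s dx dy dz ->
  admissible_step A Q b c rho y0 CN gA gmu (init_state n rho y0) dx dy dz a ->
  in_range A b.
Proof.
move=> n0 rho0 s12 s0 /newtonP[_ np hc].
case=> /andP[a0 a1] _ [_ _ [bt [ct [_ /normA_range[w Aw] hp _]]]].
have M0 := mu0_gt0 _ _ _ n0 rho0; have ME := mu0E _ rho n0.
have muaE := compl_mu_step R n _ _ dx dz s a n0 hc.
rewrite muaE in hp; rewrite -/(mu0 n rho) in np hc hp.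
set d := compl_mu dx dz in hp.
have dle : d <= (1 - s) ^+ 2 * mu0 n rho / 4%:R.
  have n1 : 0 < n%:R :> R by rewrite ltr0n.
  rewrite /d compl_muE ler_pdivrMr// [leRHS]mulr_natr.
  rewrite -[X in _ *+ X](card_ord n) -sumr_const; apply: ler_sum => i _.
  have := hc i; rewrite !mxE !mulr1 ME => hci.
  (* At the starting point [x = z = rho], so the complementarity row determines this sum. *)
  have sumE : dx i 0 + dz i 0 = - ((1 - s) * rho).
    apply: (mulfI (lt0r_neq0 rho0)); rewrite mulrDr hci; ring.
  have := sqr_ge0 (dx i 0 - dz i 0).
  have -> : (dx i 0 - dz i 0) ^+ 2 = (dx i 0 + dz i 0) ^+ 2 - 4%:R * (dx i 0 * dz i 0).
    by ring.
  by rewrite sumE; clear; lra.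
clearbody d; move: (mu0 n rho) M0 ME np hp dle => M M0 _ np hp dle.
set tau := (M * (1 - a * (1 - s)) + a ^+ 2 * d) / M.
(* [t] is the total coefficient of [bbar] in the neighbourhood equation after the step, once [dy]
   has been eliminated by the Newton equation. *)
set t := 1 - tau * (1 + a * (1 - s)).
have t0 : 0 < t.
  have aux : a ^+ 2 * d / M <= (a * (1 - s)) ^+ 2 / 4%:R.
    rewrite ler_pdivrMr//.
    have -> : (a * (1 - s)) ^+ 2 / 4%:R * M = a ^+ 2 * ((1 - s) ^+ 2 * M / 4%:R) by ring.
    by rewrite ler_wpM2l ?sqr_ge0.
  have tauE : tau = 1 - a * (1 - s) + a ^+ 2 * d / M.
    by rewrite /tau; field; rewrite gt_eqF.
  rewrite /t tauE; set u := a * (1 - s) in aux *.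
  have u0 : 0 < u by rewrite mulr_gt0// subr_gt0; lra.
  have u1 : u <= 1 by rewrite mulr_ile1 ?(ltW a0)//; lra.
  (* The right-hand side equals [1 - u ^+ 2 / 2 - u ^+ 2 * (1 - u) / 4], which is less than 1. *)
  have h1 : (1 - u + a ^+ 2 * d / M) * (1 + u) <= (1 - u + u ^+ 2 / 4%:R) * (1 + u).
    by rewrite ler_wpM2r//; lra.
  have h2 : 0 <= u ^+ 2 * (1 - u) by rewrite mulr_ge0 ?sqr_ge0//; lra.
  have h3 : 0 < u ^+ 2 by rewrite exprn_gt0.
  clear - h1 h2 h3; lra.
set bb := bbar A b rho in np hp.
have bE : b = A *m x0 n rho - bb by rewrite /bb /bbar opprB addrC subrK.
suff tbb : t *: bb = A *m (tau *: w + (a * tau - a) *: dx).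
  rewrite bE; apply: in_rangeD; first exact: in_rangeM.
  apply: in_rangeN; rewrite -[bb](scalerK (lt0r_neq0 t0)).
  by apply: in_rangeZ; rewrite tbb; exact: in_rangeM.
have dyE : dy = M^-1 *: (- (1 - s) *: bb - A *m dx).
  rewrite -[LHS](scalerK (lt0r_neq0 M0)); congr (_ *: _).
  apply: (addrI (A *m dx)); rewrite np {1}bE mulfK ?gt_eqF//.
  set v1 := A *m _; set v2 := A *m _.
  by apply/matrixP => i j; rewrite !mxE; ring.
have e1 : (M * (1 - a * (1 - s)) + a ^+ 2 * d) *: (y0 + a *: dy - y0) =
    (a * tau) *: (- (1 - s) *: bb - A *m dx).
  rewrite dyE addrAC subrr add0r !scalerA; congr (_ *: _).
  by rewrite /tau; field; rewrite gt_eqF.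
rewrite e1 -/tau mulmxDr -(scalemxAr a) {1}bE in hp.
rewrite mulmxDr -!scalemxAr Aw /t; clearbody bb tau.
move: (A *m x0 n rho) (A *m dx) hp => v1 v2 hp.
apply/matrixP => i j; have := congr1 (fun v : 'cV[R]_m => v i j) hp.
by rewrite !mxE; clear; lra.
Qed.

(** Invariant of a run, stated with the current estimates, whereas an admissible step only refers to
    the previous ones. *)
Definition centered m n (A : 'M[R]_(m, n)) Q b c rho y0 CN gA gmu
    (s : state R m n) : Prop :=
  nbhd A Q b c rho y0 CN gA gmu (compl_mu (st_x s) (st_z s))
    (st_zeta s) (st_lam s) (st_x s) (st_y s) (st_z s).

Lemma centered_init m n (A : 'M[R]_(m, n)) Q b c rho y0 CN gA gmu :
  (0 < n)%N -> 0 < rho -> 0 <= CN -> 0 <= gA -> gmu <= 1 ->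
  centered _ _ A Q b c rho y0 CN gA gmu (init_state n rho y0).
Proof.
move=> n0 rho0 CN0 gA0 gmu1; have M0 := mu0_gt0 _ _ _ n0 rho0.
have n20 k : norm2 (0 : 'cV[R]_k) = 0 by rewrite -(scale0r 0) norm2Z normr0 mul0r.
split=> /=; rewrite -/(mu0 n rho).
- by move=> i; rewrite !mxE mulr1.
- by move=> i; rewrite mu0E// !mxE mulr1 -expr2 ler_piMl ?sqr_ge0.
- exists 0, 0; split.
  + by rewrite col_mx0 n20.
  + apply/normA_leP => e e0; exists 0, 0, 0; split.
    * by rewrite mulmx0.
    * by rewrite !mulmx0 oppr0 !addr0.
    * by rewrite col_mx0 n20 addr_ge0 ?mulr_ge0// ltW.
  + rewrite divff ?gt_eqF// subrr scaler0 !addr0 scale1r /bbar.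
    by rewrite addrC subrK.
  + rewrite divff ?gt_eqF// subrr scaler0 oppr0 !addr0 scale1r /cbar.
    by rewrite [RHS]addrC subrK.
Qed.

(** If the estimates are updated, the proximal terms vanish and the acceptance test is the
    neighbourhood condition up to rescaling; otherwise admissibility of the step already gives
    it. *)
Lemma centered_step m n (A : 'M[R]_(m, n)) Q b c rho y0 CN gA gmu smin smax
    (s s' : state R m n) :
  (0 < n)%N -> 0 < rho ->
  ippmm_step A Q b c rho y0 CN gA gmu smin smax s s' ->
  centered _ _ A Q b c rho y0 CN gA gmu s'.
Proof.
move=> n0 rho0 [sg [dx [dy [dz [a [_ _ [adm _] [ex ey ez] [acc rej]]]]]]].
have M0 := mu0_gt0 _ _ _ n0 rho0.
case: s adm ex ey ez acc rej => x y z zeta lam /= [_ _ nb] ex ey ez acc rej.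
rewrite -ex -ey -ez in nb.
rewrite /centered; have [ok|nok] := pselect
    (estimate_update_test A Q b c rho y0 CN gA (st_x s') (st_y s') (st_z s')).
  have [-> ->] := acc ok; case: nb => xz0 xzg _; split => //.
  case: ok; set mu := compl_mu _ _; set rp := A *m _ - _; set rd := _ - (c + _).
  have mu_gt0 : 0 < mu by exact: compl_mu_gt0.
  have t0 : 0 < mu / mu0 n rho by rewrite divr_gt0.
  move=> rCN rA; pose t := (mu / mu0 n rho)^-1.
  have tp : 0 < t by rewrite invr_gt0.
  have tE : mu / mu0 n rho * t = 1 by rewrite mulfV// gt_eqF.
  exists (t *: rp), (t *: rd); split.
  - rewrite -scale_col_mx norm2Z gtr0_norm// mulrC ler_pdivrMr//.
  - apply: le_trans (normAZ_le _ _ _ _ _ _ _ _ _ (ltW tp) rA) _.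
    by rewrite lee_fin mulrCA mulVf ?mulr1// gt_eqF.
  - by rewrite subrr scaler0 addr0 scalerDr scalerA tE scale1r addrA addrC subrK.
  - by rewrite subrr scaler0 subr0 scalerDr scalerA tE scale1r addrA [RHS]addrC subrK.
by have [-> ->] := rej nok.
Qed.

(** A measure staying above [e] would decrease by at least the fixed amount [a / 100 * e] at each
    step, and so eventually become negative. *)
Lemma compl_mu_vanishes m n (A : 'M[R]_(m, n)) Q b c rho y0 CN gA gmu smin smax B
    (s : nat -> state R m n) :
  (0 < n)%N -> psd Q -> 0 < rho -> 0 < CN -> 0 < gA -> 0 < gmu < 1 ->
  0 < smin -> smax <= 1 / 2%:R ->
  ippmm_run A Q b c rho y0 CN gA gmu smin smax s ->
  (forall k, norm2 (st_y (s k) - st_lam (s k)) <= B) ->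
  (forall k, norm2 (st_x (s k) - st_zeta (s k)) <= B) ->
  forall e : R, 0 < e -> exists k, compl_mu (st_x (s k)) (st_z (s k)) <= e.
Proof.
move=> n0 hQ rho0 CN0 gA0 gmu01 smin0 smax12 [s_init s_step] yB xB e e0.
have /andP[gmu0 gmu1] := gmu01.
apply: contrapT => /forallNP mu_gt.
pose mu k := compl_mu (st_x (s k)) (st_z (s k)).
have mu_e k : e < mu k by rewrite ltNge; apply/negP/mu_gt.
have cent k : centered _ _ A Q b c rho y0 CN gA gmu (s k).
  case: k => [|k]; last exact: centered_step (s_step k).
  by rewrite s_init; apply: centered_init => //; exact: ltW.
have rngb : in_range A b.
  have [sg [dx [dy [dz [a [/andP[sg1 sg2] nw [adm _] _ _]]]]]] := s_step 0%N.
  rewrite s_init in nw adm; apply: first_step_range nw adm => //.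
    exact: le_trans smax12.
  exact: lt_le_trans sg1.
have [a a0 ha] := uniform_admissible_step _ _ _ A Q b c rho y0 CN gA gmu smin e B
  n0 hQ rho0 CN0 gA0 gmu01 smin0 e0 rngb.
have mu_step k : mu k <= mu0 n rho -> mu k.+1 <= mu k - a / 100%:R * e.
  move=> muM.
  have [sg [dx [dy [dz [al [/andP[sg1 sg2] nw [adm mx] [ex ey ez] _]]]]]] := s_step k.
  have sg12 : smin <= sg <= 1 / 2%:R by rewrite sg1 (le_trans sg2).
  have := cent k; have := yB k; have := xB k; have := mu_e k; move: muM.
  rewrite /mu /centered ex ez.
  case: (s k) nw adm mx => x y z zeta lam /= nw [_ mule _] mx muM mue xB' yB' cen.
  have mub : e <= compl_mu x z <= mu0 n rho by rewrite ltW.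
  (* The uniform step [a] is admissible, so the maximal step is at least [a]. *)
  have aal := mx _ (ha _ _ _ _ _ _ _ _ _ mub sg12 yB' xB' cen nw).
  apply: (le_trans mule); rewrite mulrBl mul1r lerB//.
  by apply: ler_pM; [exact: divr_ge0 (ltW a0) (ler0n _ _)|exact: ltW
    |rewrite ler_wpM2r ?invr_ge0|exact: ltW].
(* The induction also keeps [mu k] below its initial value, as [mu_step] requires. *)
have mu_lin k : mu k <= mu0 n rho - k%:R * (a / 100%:R * e).
  elim: k => [|k IHk]; first by rewrite mul0r subr0 /mu s_init.
  have kpos : 0 <= k%:R * (a / 100%:R * e).
    by rewrite !mulr_ge0 ?invr_ge0// ltW.
  apply: (le_trans (mu_step _ _)); first by apply: (le_trans IHk); rewrite gerBl.
  rewrite -[k.+1%:R]natr1 mulrDl mul1r opprD addrA lerD2r; exact: IHk.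
have q0 : 0 < a / 100%:R * e by rewrite !mulr_gt0// invr_gt0.
pose N := Num.bound (mu0 n rho / (a / 100%:R * e)).
have := mu_lin N; have := mu_e N.
have : mu0 n rho < N%:R * (a / 100%:R * e).
  rewrite -ltr_pdivrMr//; apply: archi_boundP.
  by rewrite divr_ge0// ltW// mu0_gt0.
by move: (_ * _) (mu N) (mu0 _ _) => ? ? ?; lra.
Qed.

End Run.

(** * From a vanishing complementarity measure to a KKT point *)

Lemma bounded_fun_le (R : realType) (f : nat -> R) :
  bounded_fun (f : nat -> R^o) -> exists B, forall k, f k <= B.
Proof.
by move=> /bounded_fun_has_ubound[B fB]; exists B => k; apply: fB; exists k.
Qed.

(** The perturbation and the bounded proximal term both carry the factor [mu], so feasibility
    residuals vanish along with it. *)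
Lemma proximal_residual_le (R : realType) p (v b1 bb bt w : 'cV[R]_p) (mu M C B : R) :
  0 <= mu -> 0 < M -> norm2 bt <= C -> norm2 w <= B ->
  v + mu *: w = b1 + (mu / M) *: (bb + bt) ->
  norm2 (v - b1) <= mu * ((norm2 bb + C) / M + B).
Proof.
move=> mu_ge0 M0 btC wB vE.
have -> : v - b1 = (mu / M) *: (bb + bt) + (- mu) *: w.
  by move/(canRL (addrK _)): vE => ->; apply/matrixP => i j; rewrite !mxE; ring.
apply: (le_trans (norm2D _ _ _ _)); rewrite !norm2Z normrN normrM normfV.
rewrite (ger0_norm mu_ge0) (gtr0_norm M0) mulrDr -mulrA [(_ + C) / M]mulrC.
apply: lerD; rewrite ler_wpM2l// ler_wpM2l ?invr_ge0 ?(ltW M0)//.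
by apply: (le_trans (norm2D _ _ _ _)); rewrite lerD2l.
Qed.

Theorem theorem4p3 (R : realType) (m n : nat) (hmn : (m <= n)%N)
  (A : 'M[R]_(m, n)) (Q : 'M[R]_n) (b : 'cV[R]_m) (c : 'cV[R]_n)
  (hQ : psd Q)
  (rho : R) (hrho : 0 < rho)
  (y0 : 'cV[R]_m) (Cy : R) (hy0 : forall i, `|y0 i 0| <= Cy)
  (CN gA gmu smin smax : R)
  (hCN : 0 < CN) (hgA : 0 < gA < 1) (hgmu : 0 < gmu < 1)
  (hsmin : 0 < smin) (hsminmax : smin <= smax) (hsmax : smax <= 1 / 2%:R)
  (hKKT : ~ exists x : 'cV[R]_n, exists y : 'cV[R]_m, exists z : 'cV[R]_n,
            KKT A Q b c x y z)
  (s : nat -> state R m n)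
  (hs : ippmm_run A Q b c rho y0 CN gA gmu smin smax s) :
  ~ (bounded_fun (fun k : nat => norm2 (st_y (s k) - st_lam (s k)) : R^o) /\
     bounded_fun (fun k : nat => norm2 (st_x (s k) - st_zeta (s k)) : R^o)).
Proof.
case=> /bounded_fun_le[By yBy] /bounded_fun_le[Bx xBx]; apply: hKKT.
(* If [n = 0], then [m = 0] as well and the empty triple is a KKT point. *)
have [n0|n0] := posnP n.
  have m0 : m = 0%N by apply/eqP; rewrite -leqn0 -n0.
  exists 0, 0, 0; subst m n.
  by split; [exact: flatmx0|exact: flatmx0|exact: flatmx0|case].
have /andP[gA0 _] := hgA; have /andP[gmu0 gmu1] := hgmu.
pose B := Num.max Bx By.
have yB k : norm2 (st_y (s k) - st_lam (s k)) <= B.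
  by apply: le_trans (yBy k) _; rewrite le_max lexx orbT.
have xB k : norm2 (st_x (s k) - st_zeta (s k)) <= B.
  by apply: le_trans (xBx k) _; rewrite le_max lexx.
have mu_to0 := compl_mu_vanishes _ _ _ _ _ _ _ _ _ _ _ _ _ _ _ _ n0 hQ hrho hCN gA0 hgmu
  hsmin hsmax hs yB xB.
have cent k : centered _ _ _ A Q b c rho y0 CN gA gmu (s k).
  case: hs k => s_init s_step [|k]; last exact: centered_step (s_step k).
  by rewrite s_init; apply: centered_init => //; exact: ltW.
have M0 := mu0_gt0 _ _ _ n0 hrho.
set bb := bbar A b rho; set cb := cbar A Q c rho y0.
have B0 : 0 <= B := le_trans (norm2_ge0 _ _ _) (yB 0%N).
pose N := norm2 bb + norm2 cb + CN.
have N0 : 0 <= N by rewrite /N; nonneg.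
(* Each product [x i 0 * z i 0] is at most [n * mu], and each residual at most [mu] times the
   bracket, so [mu <= e / C] makes all of them at most [e]. *)
pose C := n%:R + (N / mu0 n rho + B).
have C0 : 0 < C.
  by rewrite /C ltr_wpDr ?ltr0n// addr_ge0// divr_ge0// ltW.
apply: approx_KKT => e e0.
have [k muk] := mu_to0 (e / C) (divr_gt0 e0 C0).
exists (st_x (s k)), (st_y (s k)), (st_z (s k)).
have [xz0 _ [bt [ct [btct _ hp hd]]]] := cent k.
have mu_gt0 := compl_mu_gt0 _ _ _ _ n0 xz0.
have sumE := sum_compl_mu _ _ (st_x (s k)) (st_z (s k)) n0.
set mu := compl_mu _ _ in muk hp hd mu_gt0 sumE; clearbody mu.
have muC t : t <= C -> mu * t <= e.
  move=> tC; apply: (@le_trans _ _ (mu * C)); first by rewrite ler_wpM2l// ltW.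
  by rewrite -ler_pdivlMr.
have resC N' : N' <= N -> mu * (N' / mu0 n rho + B) <= e.
  move=> N'N; apply: muC; apply: (@le_trans _ _ (N / mu0 n rho + B)).
    by rewrite lerD2r ler_wpM2r// invr_ge0 ltW.
  by rewrite /C lerDr.
split.
- by move=> i; have [x0 z0] := xz0 i; rewrite !ltW.
- move=> i; apply: (@le_trans _ _ (mu * n%:R)); last first.
    by apply: muC; rewrite /C lerDl addr_ge0// divr_ge0// ltW.
  rewrite [leRHS]mulrC -sumE (bigD1 i)//= lerDl sumr_ge0// => j _.
  by have [x0 z0] := xz0 j; rewrite mulr_ge0// ltW.
- apply: (le_trans (proximal_residual_le _ _ _ _ _ _ _ _ _ _ _ (ltW mu_gt0) M0
    (le_trans (norm2_le_col_mxl _ _ _ _ _) btct) (yB k) hp)).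
  by apply: resC; rewrite /N -/bb -addrA lerD2l lerDr norm2_ge0.
- have qB : norm2 (- (st_x (s k) - st_zeta (s k))) <= B.
    by rewrite -scaleN1r norm2Z normrN1 mul1r.
  rewrite -[- (mu *: _)]scalerN in hd.
  apply: (le_trans (proximal_residual_le _ _ _ _ _ _ _ _ _ _ _ (ltW mu_gt0) M0
    (le_trans (norm2_le_col_mxr _ _ _ _ _) btct) qB hd)).
  by apply: resC; rewrite /N -/cb -addrA lerDr norm2_ge0.
Qed.
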